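(* Let $\beta\in\mathbb{C}$ with $|\beta|=1$ and $\beta^n\neq1$ for all $n\in\mathbb{N}$, and let $m\in\mathrm{Hol}(\mathbb{D})$ with $m(z)\neq0$ for all $z\in\mathbb{D}$. Let $T:\mathrm{Hol}(\mathbb{D})\to\mathrm{Hol}(\mathbb{D})$ be given by $(Tf)(z)=m(z)f(\beta z)$. Then (a) $\{\beta^n m(0):n\in\mathbb{N}_0\}\subset\sigma(T)\subset\{\lambda\in\mathbb{C}:|\lambda|=|m(0)|\}$; (b) $\sigma_W(T)=\{\lambda\in\mathbb{C}:|\lambda|=|m(0)|\}$.
   Context: $\mathbb{D}$ is the open unit disc, $\mathbb{N}_0=\mathbb{N}\cup\{0\}$, and $\mathrm{Hol}(\mathbb{D})$ is the Fréchet space of holomorphic functions on $\mathbb{D}$ with the topology of uniform convergence on compact subsets, given by the seminorms $\|f\|_{A(r\mathbb{D})}=\sup_{|z|\leq r}|f(z)|$, $0<r<1$. For a continuous linear operator $T$ on $\mathrm{Hol}(\mathbb{D})$, $\rho(T)$ is the set of $\lambda\in\mathbb{C}$ with $\lambda\mathrm{Id}-T$ bijective, $\sigma(T)=\mathbb{C}\setminus\rho(T)$, and $R_\lambda=(\lambda\mathrm{Id}-T)^{-1}$. The Waelbroeck resolvent set $\rho_W(T)$ is the set of $\lambda\in\rho(T)$ for which there is $\delta>0$ with $\overline{D}(\lambda,\delta)\subset\rho(T)$ and $\sup_{|\mu-\lambda|\leq\delta}\|R_\mu f\|_{A(r\mathbb{D})}<\infty$ for all $f\in\mathrm{Hol}(\mathbb{D})$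 and all $0<r<1$; $\sigma_W(T)=\mathbb{C}\setminus\rho_W(T)$. *)

(* Defs.v *)
From Stdlib Require Import Reals.
From Coquelicot Require Import Coquelicot.
Open Scope R_scope.

Definition inD (z : C) : Prop := Cmod z < 1.

(* f is holomorphic on D: complex differentiable at every point of D.
   Elements of Hol(D) are represented by functions C -> C; only their
   values on D matter (see [eqD]). *)
Definition Hol (f : C -> C) : Prop :=
  forall z, inD z -> exists l : C,
    @is_derive C_AbsRing C_NormedModule f z l.

Definition eqD (f g : C -> C) : Prop := forall z, inD z -> f z = g z.

Definition Top (m : C -> C) (beta : C) (f : C -> C) : C -> C :=
  fun z => Cmult (m z) (f (Cmult beta z)).

Definition shiftT (m : C -> C) (beta lam : C) (f : C -> C) : C -> C :=
  fun z => Cminus (Cmult lam (f z)) (Top m beta f z).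

Definition in_resolvent (m : C -> C) (beta lam : C) : Prop :=
  (forall f, Hol f -> eqD (shiftT m beta lam f) (fun _ => RtoC 0) ->
      eqD f (fun _ => RtoC 0)) /\
  (forall g, Hol g -> exists f, Hol f /\ eqD (shiftT m beta lam f) g).

Definition in_spectrum (m : C -> C) (beta lam : C) : Prop :=
  ~ in_resolvent m beta lam.

(* Waelbroeck resolvent set. For mu in rho(T), R_mu g is the unique f in
   Hol(D) with (mu Id - T) f = g on D, so bounding every such f bounds
   ||R_mu g||_{A(rD)}. *)
Definition in_W_resolvent (m : C -> C) (beta lam : C) : Prop :=
  in_resolvent m beta lam /\
  exists delta : R, 0 < delta /\
    (forall mu, Cmod (Cminus mu lam) <= delta -> in_resolvent m beta mu) /\
    (forall g, Hol g -> forall r : R, 0 < r < 1 ->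
       exists M : R, forall mu, Cmod (Cminus mu lam) <= delta ->
         forall f, Hol f -> eqD (shiftT m beta mu f) g ->
           forall z, Cmod z <= r -> Cmod (f z) <= M).

Definition in_W_spectrum (m : C -> C) (beta lam : C) : Prop :=
  ~ in_W_resolvent m beta lam.

(* Main.v *)
Require Import Defs.
From Stdlib Require Import Reals Lra Lia Psatz Classical ClassicalEpsilon.
From Coquelicot Require Import Coquelicot.
Open Scope R_scope.

(* Goursat's bisection argument, run on polar rectangles in the (r, t)-plane, shows that the circle
   integrals of k dz do not depend on the radius; applied to f(z) / z^(n+1) and to the difference
   quotient of f this yields the power series of a function that is only assumed complex
   differentiable, with Cauchy's estimates.

   Off the circle |lam| = |m(0)|, the resolvent equation takes the form f = G + c n (f o gam), with
   n = m, gam = beta outside the circle and n(z) = 1 / m(z / beta), gam = 1 / beta inside. Its Neumann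
   series converges once |n(z) n(gam z) ... n(gam^(k-1) z)| <= K (kappa |n(0)|)^k locally uniformly
   for every kappa > 1. On compact sets ln|n| - ln|n(0)| is within ln kappa of the real part of a
   polynomial without constant term (integrate a polynomial approximation of n'/n along rays), and
   Birkhoff sums of such a polynomial along the rotation are bounded because gam is not a root of
   unity.

   For lam = beta^n m(0), the equation (lam - T) f = z^n is triangular in the Taylor coefficients,
   with zero diagonal entry exactly at degree n, so it has no solution. As these points are dense in
   the circle, no closed disc centred on the circle is contained in the resolvent set. *)

(** * Complex derivatives *)

(** The obstacle is arithmetic. If ln|n| - ln|n(0)| were a coboundary over the rotation by gam with
    a continuous transfer function, the cocycle would be at most a constant times |n(0)|^k on
    compact sets. Solving that equation divides Taylor coefficients by gam^j - 1, and these divisors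
    can be arbitrarily small, since gam is only known not to be a root of unity. A polynomial
    involves finitely many divisors, each nonzero; the price of the truncation is a factor kappa per
    step, which a point off the circle can afford. The resulting constants depend on lam only
    through an upper bound q < 1 for |c n(0)|, so they serve a whole small disc of parameters at
    once, as the Waelbroeck condition demands. On the circle this room is gone, and there sigma(T)
    is only shown to contain the points beta^n m(0).

    Working with ln|n| and n'/n avoids choosing a branch of log n. The density of the orbit of beta
    is drawn from the same bounded Birkhoff sums that control the cocycle. *)

Definition cdiff (f : C -> C) (z l : C) : Prop :=
  forall eps : R, 0 < eps -> exists d : R, 0 < d /\
    forall w : C, Cmod (w - z) < d ->
      Cmod (f w - f z - l * (w - z)) <= eps * Cmod (w - z).

Definition ccont (f : C -> C) (z : C) : Prop :=
  forall eps : R, 0 < eps -> exists d : R, 0 < d /\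
    forall w : C, Cmod (w - z) < d -> Cmod (f w - f z) < eps.

Lemma is_derive_cdiff (f : C -> C) (z l : C) :
  @is_derive C_AbsRing C_NormedModule f z l <-> cdiff f z l.
Proof.
  split.
  - intros [_ H] eps Heps.
    specialize (H z (fun P HP => HP) (mkposreal eps Heps)).
    destruct H as [d Hd].
    exists d; split; [apply cond_pos|].
    intros w Hw.
    specialize (Hd w Hw); simpl in Hd.
    replace (l * (w - z))%C with ((w - z) * l)%C by ring.
    exact Hd.
  - intros H; split.
    + apply is_linear_scal_l.
    + intros x Hx.
      (* The derivative condition ranges over every limit [x] of the neighbourhood filter of [z];
         that limit is unique. *)
      assert (E : z = x) by (apply (is_filter_lim_locally_unique (V := AbsRing_NormedModule C_AbsRing)); exact Hx).
      rewrite <- E.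
      intros eps.
      destruct (H eps (cond_pos eps)) as [d [Hd Hw]].
      exists (mkposreal d Hd).
      intros w Hb.
      specialize (Hw w Hb).
      replace (l * (w - z))%C with ((w - z) * l)%C in Hw by ring.
      exact Hw.
Qed.

Lemma Hol_cdiff (f : C -> C) :
  Hol f <-> forall z, inD z -> exists l, cdiff f z l.
Proof.
  split; intros H z Hz; destruct (H z Hz) as [l Hl]; exists l;
    now apply is_derive_cdiff.
Qed.

Lemma Cmod_triangle_rev (x y : C) : Cmod x - Cmod y <= Cmod (x - y).
Proof.
  generalize (Cmod_triangle (x - y) y).
  replace (x - y + y)%C with x by ring. lra.
Qed.

Lemma Cmod_minus_le (x y : C) : Cmod (x - y) <= Cmod x + Cmod y.
Proof. rewrite <- (Cmod_opp y). apply Cmod_triangle. Qed.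

Lemma Cmod_sub_sym (x y : C) : Cmod (x - y) = Cmod (y - x).
Proof. rewrite <- Cmod_opp. f_equal. ring. Qed.

Lemma Cmod_small_eq_0 (z : C) : (forall e, 0 < e -> Cmod z <= e) -> z = RtoC 0.
Proof.
  intros H. apply Cmod_eq_0. generalize (Cmod_ge_0 z). intros H0.
  destruct (Req_dec (Cmod z) 0) as [E|E]; [exact E|].
  specialize (H (Cmod z / 2)). lra.
Qed.

Lemma cdiff_ext_loc (f g : C -> C) (z l : C) (d : R) :
  0 < d -> (forall w, Cmod (w - z) < d -> f w = g w) -> cdiff f z l -> cdiff g z l.
Proof.
  intros Hd E H eps Heps.
  destruct (H eps Heps) as [d' [Hd' Hw]].
  exists (Rmin d d'); split; [now apply Rmin_pos|].
  intros w Hw'.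
  assert (Cmod (w - z) < d) by (eapply Rlt_le_trans; [exact Hw'|apply Rmin_l]).
  assert (Cmod (w - z) < d') by (eapply Rlt_le_trans; [exact Hw'|apply Rmin_r]).
  rewrite <- !E; auto.
  replace (z - z)%C with (RtoC 0) by ring. now rewrite Cmod_0.
Qed.

Lemma cdiff_ccont (f : C -> C) (z l : C) : cdiff f z l -> ccont f z.
Proof.
  intros H eps Heps.
  destruct (H 1 Rlt_0_1) as [d [Hd Hw]].
  assert (Hl : 0 < 1 + Cmod l) by (generalize (Cmod_ge_0 l); lra).
  exists (Rmin d (eps / (1 + Cmod l))); split.
  - apply Rmin_pos; auto. now apply Rdiv_lt_0_compat.
  - intros w H1.
    assert (H2 : Cmod (w - z) < d) by (eapply Rlt_le_trans; [exact H1|apply Rmin_l]).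
    assert (H3 : Cmod (w - z) < eps / (1 + Cmod l)) by (eapply Rlt_le_trans; [exact H1|apply Rmin_r]).
    specialize (Hw w H2).
    replace (f w - f z)%C with ((f w - f z - l * (w - z)) + l * (w - z))%C by ring.
    eapply Rle_lt_trans; [apply Cmod_triangle|].
    rewrite Cmod_mult.
    apply Rle_lt_trans with ((1 + Cmod l) * Cmod (w - z)); [lra|].
    apply Rmult_lt_compat_l with (r := 1 + Cmod l) in H3; auto.
    replace ((1 + Cmod l) * (eps / (1 + Cmod l))) with eps in H3 by (field; lra).
    exact H3.
Qed.

Lemma ccont_plus (f g : C -> C) z : ccont f z -> ccont g z -> ccont (fun w => f w + g w)%C z.
Proof.
  intros Hf Hg eps Heps.
  destruct (Hf (eps / 2)) as [d1 [Hd1 H1]]; [lra|].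
  destruct (Hg (eps / 2)) as [d2 [Hd2 H2]]; [lra|].
  exists (Rmin d1 d2); split; [now apply Rmin_pos|].
  intros w Hw.
  assert (A1 := H1 w (Rlt_le_trans _ _ _ Hw (Rmin_l _ _))).
  assert (A2 := H2 w (Rlt_le_trans _ _ _ Hw (Rmin_r _ _))).
  replace (f w + g w - (f z + g z))%C with ((f w - f z) + (g w - g z))%C by ring.
  eapply Rle_lt_trans; [apply Cmod_triangle|]. lra.
Qed.

Lemma ccont_const c z : ccont (fun _ => c) z.
Proof.
  intros eps Heps. exists 1; split; [lra|]. intros w _.
  replace (c - c)%C with (RtoC 0) by ring. now rewrite Cmod_0.
Qed.

Lemma ccont_id z : ccont (fun w => w) z.
Proof. intros eps Heps. exists eps; split; auto. Qed.

Lemma ccont_mult (f g : C -> C) z : ccont f z -> ccont g z -> ccont (fun w => f w * g w)%C z.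
Proof.
  intros Hf Hg eps Heps.
  assert (P1 := Cmod_ge_0 (f z)). assert (P2 := Cmod_ge_0 (g z)).
  (* Error budget: eps/4 for the product of the two increments, eps/2 for [(f w - f z) * g z], eps/4
     for [f z * (g w - g z)]. The 1 in the denominators covers the case where [f z] or [g z] is
     0. *)
  set (e1 := eps / (2 * (1 + Cmod (g z)))).
  set (e2 := eps / (2 * (1 + Cmod (f z)))).
  assert (He1 : 0 < e1) by (apply Rdiv_lt_0_compat; lra).
  destruct (Hf (Rmin 1 e1)) as [d1 [Hd1 H1]]; [apply Rmin_pos; lra|].
  destruct (Hg (eps / 4)) as [d3 [Hd3 H3]]; [lra|].
  destruct (Hg (e2 / 2)) as [d4 [Hd4 H4]].
  { unfold e2. apply Rdiv_lt_0_compat; [|lra]. apply Rdiv_lt_0_compat; lra. }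
  exists (Rmin d1 (Rmin d3 d4)); split; [repeat apply Rmin_pos; auto|].
  intros w Hw.
  assert (A1 := H1 w (Rlt_le_trans _ _ _ Hw (Rmin_l _ _))).
  assert (Hw' := Rlt_le_trans _ _ _ Hw (Rmin_r _ _)).
  assert (A3 := H3 w (Rlt_le_trans _ _ _ Hw' (Rmin_l _ _))).
  assert (A4 := H4 w (Rlt_le_trans _ _ _ Hw' (Rmin_r _ _))).
  assert (A11 := Rlt_le_trans _ _ _ A1 (Rmin_l _ _)).
  assert (A12 := Rlt_le_trans _ _ _ A1 (Rmin_r _ _)).
  replace (f w * g w - f z * g z)%C
    with ((f w - f z) * (g w - g z) + (f w - f z) * g z + f z * (g w - g z))%C by ring.
  eapply Rle_lt_trans; [apply Cmod_triangle|].
  eapply Rle_lt_trans; [apply Rplus_le_compat_r, Cmod_triangle|].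
  rewrite !Cmod_mult.
  assert (Q1 := Cmod_ge_0 (f w - f z)). assert (Q2 := Cmod_ge_0 (g w - g z)).
  assert (B1 : Cmod (f w - f z) * Cmod (g w - g z) <= eps / 4) by nra.
  assert (B2 : Cmod (f w - f z) * Cmod (g z) <= eps / 2).
  { apply Rle_trans with (e1 * (1 + Cmod (g z))); [nra|].
    unfold e1. apply Req_le. field. lra. }
  assert (B3 : Cmod (f z) * Cmod (g w - g z) < eps / 4 + 0).
  { apply Rle_lt_trans with (Cmod (f z) * (e2 / 2)); [nra|].
    apply Rlt_le_trans with ((1 + Cmod (f z)) * (e2 / 2)).
    - apply Rmult_lt_compat_r; lra.
    - unfold e2. apply Req_le. field. lra. }
  lra.
Qed.

Lemma ccont_scale (f : C -> C) (g z : C) : ccont f (g * z)%C -> ccont (fun w => f (g * w)%C) z.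
Proof.
  intros H eps Heps. destruct (H eps Heps) as [d [Hd Hw]].
  assert (P := Cmod_ge_0 g).
  exists (d / (1 + Cmod g)); split; [apply Rdiv_lt_0_compat; lra|].
  intros w H1. apply Hw.
  replace (g * w - g * z)%C with (g * (w - z))%C by ring. rewrite Cmod_mult.
  apply Rle_lt_trans with ((1 + Cmod g) * Cmod (w - z)).
  - generalize (Cmod_ge_0 (w - z)); nra.
  - apply Rmult_lt_compat_l with (r := 1 + Cmod g) in H1; [|lra].
    replace ((1 + Cmod g) * (d / (1 + Cmod g))) with d in H1 by (field; lra). exact H1.
Qed.

Lemma cdiff_const c z : cdiff (fun _ => c) z (RtoC 0).
Proof.
  intros eps Heps. exists 1; split; [lra|]. intros w _.
  replace (c - c - 0 * (w - z))%C with (RtoC 0) by ring. rewrite Cmod_0.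
  apply Rmult_le_pos; [lra|apply Cmod_ge_0].
Qed.

Lemma cdiff_id z : cdiff (fun w => w) z (RtoC 1).
Proof.
  intros eps Heps. exists 1; split; [lra|]. intros w _.
  replace (w - z - 1 * (w - z))%C with (RtoC 0) by ring. rewrite Cmod_0.
  apply Rmult_le_pos; [lra|apply Cmod_ge_0].
Qed.

Lemma cdiff_plus (f g : C -> C) z lf lg :
  cdiff f z lf -> cdiff g z lg -> cdiff (fun w => f w + g w)%C z (lf + lg)%C.
Proof.
  intros Hf Hg eps Heps.
  destruct (Hf (eps / 2)) as [d1 [Hd1 H1]]; [lra|].
  destruct (Hg (eps / 2)) as [d2 [Hd2 H2]]; [lra|].
  exists (Rmin d1 d2); split; [now apply Rmin_pos|].
  intros w Hw.
  assert (A1 := H1 w (Rlt_le_trans _ _ _ Hw (Rmin_l _ _))).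
  assert (A2 := H2 w (Rlt_le_trans _ _ _ Hw (Rmin_r _ _))).
  replace (f w + g w - (f z + g z) - (lf + lg) * (w - z))%C
    with ((f w - f z - lf * (w - z)) + (g w - g z - lg * (w - z)))%C by ring.
  eapply Rle_trans; [apply Cmod_triangle|]. lra.
Qed.

(* Caratheodory: [f] is differentiable iff [f w - f z = phi w (w - z)] with [phi] continuous at [z]. *)
Lemma cdiff_slope (f : C -> C) z l :
  cdiff f z l <-> exists phi, ccont phi z /\ phi z = l /\
    (forall w, f w = f z + phi w * (w - z))%C.
Proof.
  split.
  - intros H.
    exists (fun w => match excluded_middle_informative (w = z) with
                     | left _ => l | right _ => ((f w - f z) / (w - z))%C end).
    repeat split.
    + intros eps Heps. destruct (H (eps / 2)) as [d [Hd Hw]]; [lra|].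
      exists d; split; auto. intros w H1.
      destruct (excluded_middle_informative (z = z)) as [_|n]; [|easy].
      destruct (excluded_middle_informative (w = z)) as [E|n].
      * replace (l - l)%C with (RtoC 0) by ring. now rewrite Cmod_0.
      * assert (N : (w - z)%C <> RtoC 0) by (intros E; apply n; rewrite <- (Cplus_0_l z), <- E; ring).
        replace ((f w - f z) / (w - z) - l)%C with ((f w - f z - l * (w - z)) / (w - z))%C by (field; auto).
        rewrite Cmod_div by auto.
        assert (P : 0 < Cmod (w - z)) by now apply Cmod_gt_0.
        apply Rlt_div_l; auto.
        eapply Rle_lt_trans; [apply Hw; auto|]. nra.
    + destruct (excluded_middle_informative (z = z)); easy.
    + intros w. destruct (excluded_middle_informative (w = z)) as [E|n].
      * rewrite E. ring.
      * field. intros E; apply n; rewrite <- (Cplus_0_l z), <- E; ring.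
  - intros [phi [Hc [E H]]] eps Heps.
    destruct (Hc eps Heps) as [d [Hd Hw]]. exists d; split; auto.
    intros w H1. rewrite (H w).
    replace (f z + phi w * (w - z) - f z - l * (w - z))%C with ((phi w - phi z) * (w - z))%C
      by (rewrite E; ring).
    rewrite Cmod_mult. apply Rmult_le_compat_r; [apply Cmod_ge_0|]. left; auto.
Qed.

Lemma cdiff_mult (f g : C -> C) z lf lg :
  cdiff f z lf -> cdiff g z lg -> cdiff (fun w => f w * g w)%C z (lf * g z + f z * lg)%C.
Proof.
  intros Hf Hg.
  destruct (proj1 (cdiff_slope _ _ _) Hf) as [p [Hp [Ep Ef]]].
  destruct (proj1 (cdiff_slope _ _ _) Hg) as [q [Hq [Eq Eg]]].
  apply cdiff_slope. exists (fun w => p w * g w + f z * q w)%C. repeat split.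
  - apply ccont_plus; apply ccont_mult; auto; [|apply ccont_const].
    eapply cdiff_ccont; eauto.
  - now rewrite Ep, Eq.
  - intros w. rewrite (Ef w), (Eg w). ring.
Qed.

Lemma ccont_inv (f : C -> C) z : ccont f z -> f z <> RtoC 0 -> ccont (fun w => / f w)%C z.
Proof.
  intros H N eps Heps.
  assert (P : 0 < Cmod (f z)) by now apply Cmod_gt_0.
  set (A := Cmod (f z)) in *.
  assert (He : 0 < Rmin (A / 2) (eps * (A * A / 4))).
  { apply Rmin_pos; [lra|]. apply Rmult_lt_0_compat; [lra|]. generalize (Rmult_lt_0_compat _ _ P P). lra. }
  destruct (H _ He) as [d [Hd Hw]]. exists d; split; auto.
  intros w H1. specialize (Hw w H1).
  assert (B1 := Rlt_le_trans _ _ _ Hw (Rmin_l _ _)).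
  assert (B2 := Rlt_le_trans _ _ _ Hw (Rmin_r _ _)).
  assert (P2 : A / 2 < Cmod (f w)).
  { generalize (Cmod_triangle_rev (f z) (f w)). rewrite Cmod_sub_sym. fold A. lra. }
  assert (N2 : f w <> RtoC 0) by (apply Cmod_gt_0; lra).
  replace (/ f w - / f z)%C with ((f z - f w) / (f w * f z))%C by (field; auto).
  rewrite Cmod_div by (now apply Cmult_neq_0). rewrite Cmod_mult. fold A.
  rewrite Cmod_sub_sym.
  apply Rlt_div_l; [nra|]. eapply Rlt_le_trans; [exact B2|].
  apply Rmult_le_compat_l; nra.
Qed.

Lemma cdiff_inv (f : C -> C) z l :
  cdiff f z l -> f z <> RtoC 0 -> cdiff (fun w => / f w)%C z (- l / (f z * f z))%C.
Proof.
  intros H N.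
  destruct (proj1 (cdiff_slope _ _ _) H) as [p [Hp [Ep Ef]]].
  assert (Hc := cdiff_ccont _ _ _ H).
  destruct (Hc (Cmod (f z))) as [d [Hd Hw]]; [now apply Cmod_gt_0|].
  assert (NN : forall w, Cmod (w - z) < d -> f w <> RtoC 0).
  { intros w H1 E. specialize (Hw w H1). rewrite E in Hw.
    replace (0 - f z)%C with (- f z)%C in Hw by ring. rewrite Cmod_opp in Hw. lra. }
  intros eps Heps.
  (* This slope of [/ f] is valid only near [z], where [f] does not vanish, while [cdiff_slope] asks
     for an identity at all [w]; hence the return to epsilon and delta. *)
  assert (Hq : ccont (fun w => - p w * (/ f w * / f z))%C z).
  { apply ccont_mult.
    - intros e He. destruct (Hp e He) as [d' [Hd' H']]. exists d'; split; auto.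
      intros w H1. replace (- p w - - p z)%C with (- (p w - p z))%C by ring.
      rewrite Cmod_opp; auto.
    - apply ccont_mult; [now apply ccont_inv|apply ccont_const]. }
  destruct (Hq eps Heps) as [d' [Hd' Hw']].
  exists (Rmin d d'); split; [now apply Rmin_pos|].
  intros w H1.
  assert (Nw := NN w (Rlt_le_trans _ _ _ H1 (Rmin_l _ _))).
  assert (B := Hw' w (Rlt_le_trans _ _ _ H1 (Rmin_r _ _))).
  replace (/ f w - / f z - - l / (f z * f z) * (w - z))%C
    with ((- p w * (/ f w * / f z) - - p z * (/ f z * / f z)) * (w - z))%C.
  - rewrite Cmod_mult. apply Rmult_le_compat_r; [apply Cmod_ge_0|]. now left.
  - assert (E1 : (/ f w - / f z = - p w * (/ f w * / f z) * (w - z))%C).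
    { replace (/ f w - / f z)%C with (- (f w - f z) * (/ f w * / f z))%C by (field; auto).
      rewrite (Ef w) at 1. ring. }
    rewrite E1, Ep. field; auto.
Qed.

Lemma cdiff_scale (f : C -> C) (g z l : C) :
  cdiff f (g * z)%C l -> cdiff (fun w => f (g * w)%C) z (g * l)%C.
Proof.
  intros H.
  destruct (proj1 (cdiff_slope _ _ _) H) as [p [Hp [Ep Ef]]].
  apply cdiff_slope. exists (fun w => g * p (g * w))%C. repeat split.
  - apply ccont_mult; [apply ccont_const|]. now apply ccont_scale.
  - now rewrite Ep.
  - intros w. rewrite (Ef (g * w)%C). ring.
Qed.

Lemma cdiff_cmult (c : C) (f : C -> C) z l : cdiff f z l -> cdiff (fun w => c * f w)%C z (c * l)%C.
Proof.
  intros H. replace (c * l)%C with (0 * f z + c * l)%C by ring.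
  apply (cdiff_mult (fun _ => c) f); [apply cdiff_const|exact H].
Qed.

Lemma inD_nbhd (z : C) : inD z -> exists d, 0 < d /\ forall w, Cmod (w - z) < d -> inD w.
Proof.
  intros Hz. exists (1 - Cmod z). unfold inD in *. split; [lra|].
  intros w Hw. generalize (Cmod_triangle (w - z) z).
  replace (w - z + z)%C with w by ring. lra.
Qed.

Lemma Hol_const c : Hol (fun _ => c).
Proof. apply Hol_cdiff. intros z _. exists (RtoC 0). apply cdiff_const. Qed.

Lemma Hol_id : Hol (fun z => z).
Proof. apply Hol_cdiff. intros z _. exists (RtoC 1). apply cdiff_id. Qed.

Lemma Hol_plus f g : Hol f -> Hol g -> Hol (fun z => f z + g z)%C.
Proof.
  rewrite !Hol_cdiff. intros Hf Hg z Hz.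
  destruct (Hf z Hz) as [l Hl]. destruct (Hg z Hz) as [k Hk].
  eexists. apply cdiff_plus; eauto.
Qed.

Lemma Hol_mult f g : Hol f -> Hol g -> Hol (fun z => f z * g z)%C.
Proof.
  rewrite !Hol_cdiff. intros Hf Hg z Hz.
  destruct (Hf z Hz) as [l Hl]. destruct (Hg z Hz) as [k Hk].
  eexists. apply cdiff_mult; eauto.
Qed.

Lemma Hol_inv f : Hol f -> (forall z, inD z -> f z <> RtoC 0) -> Hol (fun z => / f z)%C.
Proof.
  rewrite !Hol_cdiff. intros Hf N z Hz.
  destruct (Hf z Hz) as [l Hl]. eexists. apply cdiff_inv; eauto.
Qed.

Lemma Hol_pow n : Hol (fun z => z ^ n)%C.
Proof.
  induction n; [apply (Hol_const (RtoC 1))|].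
  apply (Hol_mult (fun z => z) _ Hol_id IHn).
Qed.

Lemma inD_rot (g z : C) : Cmod g = 1 -> inD z -> inD (g * z)%C.
Proof. unfold inD. intros H. now rewrite Cmod_mult, H, Rmult_1_l. Qed.

Lemma Hol_rot f g : Cmod g = 1 -> Hol f -> Hol (fun z => f (g * z)%C).
Proof.
  rewrite !Hol_cdiff. intros Hg Hf z Hz.
  destruct (Hf _ (inD_rot g z Hg Hz)) as [l Hl].
  eexists. apply cdiff_scale; eauto.
Qed.

(** * Bisection and integrals of complex-valued functions *)

Lemma nested_intervals (u v : nat -> R) :
  (forall n, u n <= u (S n)) -> (forall n, v (S n) <= v n) -> (forall n, u n <= v n) ->
  exists x, forall n, u n <= x <= v n.
Proof.
  intros Hu Hv Huv.
  assert (Mu : forall n p, u n <= u (n + p)%nat).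
  { intros n p; induction p; [rewrite Nat.add_0_r; lra|].
    rewrite Nat.add_succ_r. eapply Rle_trans; [exact IHp|apply Hu]. }
  assert (Mv : forall n p, v (n + p)%nat <= v n).
  { intros n p; induction p; [rewrite Nat.add_0_r; lra|].
    rewrite Nat.add_succ_r. eapply Rle_trans; [apply Hv|exact IHp]. }
  assert (Muv : forall n p, u n <= v p).
  { intros n p. apply Rle_trans with (u (n + p)%nat); [apply Mu|].
    apply Rle_trans with (v (n + p)%nat); [apply Huv|]. rewrite Nat.add_comm. apply Mv. }
  destruct (completeness (fun x => exists n, x = u n)) as [x [Hub Hlub]].
  - exists (v 0%nat). intros y [n ->]. apply Muv.
  - exists (u 0%nat); eauto.
  - exists x. intros n; split; [apply Hub; eauto|].
    apply Hlub. intros y [p ->]. apply Muv.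
Qed.



(** Some quarter of a rectangle carries at least a quarter of |Phi|, so after n bisections |Phi| is
    at least 4^(-n) times its initial value. The local bound is eps times the squared size, which
    also scales like 4^(-n); as eps is arbitrary, the initial value is 0. *)
Lemma bisection_zero (Phi : R -> R -> R -> R -> C) (a b c d : R) :
  a <= b -> c <= d ->
  (forall a' x b' c' d', a <= a' -> a' <= x -> x <= b' -> b' <= b ->
     c <= c' -> c' <= d' -> d' <= d -> (Phi a' b' c' d' = Phi a' x c' d' + Phi x b' c' d')%C) ->
  (forall a' b' c' y d', a <= a' -> a' <= b' -> b' <= b ->
     c <= c' -> c' <= y -> y <= d' -> d' <= d -> (Phi a' b' c' d' = Phi a' b' c' y + Phi a' b' y d')%C) ->
  (forall x y eps, a <= x <= b -> c <= y <= d -> 0 < eps -> exists delta, 0 < delta /\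
     forall a' b' c' d', a <= a' -> a' <= x <= b' -> b' <= b -> c <= c' -> c' <= y <= d' -> d' <= d ->
       b' - a' < delta -> d' - c' < delta ->
       Cmod (Phi a' b' c' d') <= eps * ((b' - a') + (d' - c')) ^ 2) ->
  Phi a b c d = RtoC 0.
Proof.
  intros Hab Hcd Sx Sy Loc.
  set (N := fun q : R * R * R * R => let '(a, b, c, d) := q in Cmod (Phi a b c d)).
  (* The last branch needs no test: if three quarters fall below [N q / 4], the triangle inequality
     leaves enough for the fourth. *)
  set (step := fun q : R * R * R * R => let '(a, b, c, d) := q in
    let x := (a + b) / 2 in let y := (c + d) / 2 in
    if Rle_dec (N q / 4) (N (a, x, c, y)) then (a, x, c, y) else
    if Rle_dec (N q / 4) (N (a, x, y, d)) then (a, x, y, d) else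
    if Rle_dec (N q / 4) (N (x, b, c, y)) then (x, b, c, y) else (x, b, y, d)).
  set (ok := fun q : R * R * R * R => let '(a', b', c', d') := q in
    a <= a' /\ a' <= b' /\ b' <= b /\ c <= c' /\ c' <= d' /\ d' <= d).
  set (pa := fun q : R * R * R * R => let '(a', b', c', d') := q in a').
  set (pb := fun q : R * R * R * R => let '(a', b', c', d') := q in b').
  set (pc := fun q : R * R * R * R => let '(a', b', c', d') := q in c').
  set (pd := fun q : R * R * R * R => let '(a', b', c', d') := q in d').
  assert (Hstep : forall q, ok q -> ok (step q) /\ N q / 4 <= N (step q) /\
     pa q <= pa (step q) /\ pb (step q) <= pb q /\ pc q <= pc (step q) /\ pd (step q) <= pd q /\
     pb (step q) - pa (step q) = (pb q - pa q) / 2 /\ pd (step q) - pc (step q) = (pd q - pc q) / 2).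
  { intros [[[a' b'] c'] d'] (H1 & H2 & H3 & H4 & H5 & H6).
    set (x := (a' + b') / 2). set (y := (c' + d') / 2).
    assert (Hx : a' <= x <= b') by (unfold x; lra).
    assert (Hy : c' <= y <= d') by (unfold y; lra).
    assert (T : N (a', b', c', d') <= N (a', x, c', y) + N (a', x, y, d') + N (x, b', c', y) + N (x, b', y, d')).
    { unfold N. rewrite (Sx a' x b' c' d') by lra.
      rewrite (Sy a' x c' y d') by lra. rewrite (Sy x b' c' y d') by lra.
      eapply Rle_trans; [apply Cmod_triangle|].
      generalize (Cmod_triangle (Phi a' x c' y) (Phi a' x y d')).
      generalize (Cmod_triangle (Phi x b' c' y) (Phi x b' y d')). lra. }
    assert (Hx2 : x - a' = (b' - a') / 2 /\ b' - x = (b' - a') / 2) by (unfold x; lra).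
    assert (Hy2 : y - c' = (d' - c') / 2 /\ d' - y = (d' - c') / 2) by (unfold y; lra).
    unfold step. fold x y. clearbody x y.
    unfold N, ok, pa, pb, pc, pd in *.
    destruct Rle_dec as [D1|D1]; [repeat split; lra|].
    destruct Rle_dec as [D2|D2]; [repeat split; lra|].
    destruct Rle_dec as [D3|D3]; [repeat split; lra|].
    repeat split; lra. }
  set (q := fun n => Nat.iter n step (a, b, c, d)).
  assert (Hok : forall n, ok (q n)).
  { induction n; [unfold q; simpl; lra|]. apply (Hstep (q n) IHn). }
  assert (HN : forall n, N (a, b, c, d) * (1 / 4) ^ n <= N (q n)).
  { induction n; [change (N (a, b, c, d) * 1 <= N (a, b, c, d)); lra|].
    destruct (Hstep (q n) (Hok n)) as (_ & H & _).
    change (N (a, b, c, d) * (1 / 4 * (1 / 4) ^ n) <= N (step (q n))). lra. }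
  assert (Hl1 : forall n, pb (q n) - pa (q n) = (b - a) * (1 / 2) ^ n).
  { induction n; [change (b - a = (b - a) * 1); lra|].
    destruct (Hstep (q n) (Hok n)) as (_ & _ & _ & _ & _ & _ & H & _).
    change (pb (step (q n)) - pa (step (q n)) = (b - a) * (1 / 2 * (1 / 2) ^ n)). lra. }
  assert (Hl2 : forall n, pd (q n) - pc (q n) = (d - c) * (1 / 2) ^ n).
  { induction n; [change (d - c = (d - c) * 1); lra|].
    destruct (Hstep (q n) (Hok n)) as (_ & _ & _ & _ & _ & _ & _ & H).
    change (pd (step (q n)) - pc (step (q n)) = (d - c) * (1 / 2 * (1 / 2) ^ n)). lra. }
  assert (Hok' : forall n, a <= pa (q n) /\ pa (q n) <= pb (q n) /\ pb (q n) <= b /\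
     c <= pc (q n) /\ pc (q n) <= pd (q n) /\ pd (q n) <= d).
  { intros n. generalize (Hok n). now destruct (q n) as [[[? ?] ?] ?]. }
  destruct (nested_intervals (fun n => pa (q n)) (fun n => pb (q n))) as [x Hx].
  { intros n. apply (Hstep (q n) (Hok n)). } { intros n. apply (Hstep (q n) (Hok n)). }
  { intros n. apply Hok'. }
  destruct (nested_intervals (fun n => pc (q n)) (fun n => pd (q n))) as [y Hy].
  { intros n. apply (Hstep (q n) (Hok n)). } { intros n. apply (Hstep (q n) (Hok n)). }
  { intros n. apply Hok'. }
  apply Cmod_eq_0.
  destruct (Req_dec (Cmod (Phi a b c d)) 0) as [E|E]; [exact E|exfalso].
  assert (P : 0 < Cmod (Phi a b c d)) by (generalize (Cmod_ge_0 (Phi a b c d)); lra).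
  set (S := (b - a) + (d - c)).
  (* This makes eps * S^2 strictly smaller than |Phi|, also for a degenerate rectangle with S =
     0. *)
  set (eps := Cmod (Phi a b c d) / (S ^ 2 + 1)).
  assert (HS : 0 < S ^ 2 + 1) by nra.
  assert (Heps : 0 < eps) by now apply Rdiv_lt_0_compat.
  destruct (Loc x y eps) as [delta [Hdelta HL]]; auto.
  { exact (Hx 0%nat). } { exact (Hy 0%nat). }
  destruct (pow_lt_1_zero (1 / 2)) with (y := delta / (S + 1)) as [n Hn].
  { rewrite Rabs_pos_eq; lra. }
  { apply Rdiv_lt_0_compat; unfold S; lra. }
  specialize (Hn n (Nat.le_refl n)).
  assert (Pn : 0 < (1 / 2) ^ n) by (apply pow_lt; lra).
  rewrite Rabs_pos_eq in Hn by lra.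
  assert (Hn' : (S + 1) * (1 / 2) ^ n < delta).
  { apply Rmult_lt_compat_l with (r := S + 1) in Hn; [|unfold S; lra].
    replace ((S + 1) * (delta / (S + 1))) with delta in Hn by (field; unfold S; lra). exact Hn. }
  generalize (HN n) (Hl1 n) (Hl2 n) (Hok' n) (Hx n) (Hy n).
  destruct (q n) as [[[a' b'] c'] d']. simpl. intros A1 A2 A3 A4 A5 A6.
  assert (B := HL a' b' c' d').
  assert (B' : Cmod (Phi a' b' c' d') <= eps * (b' - a' + (d' - c')) ^ 2).
  { apply B; try lra.
    - rewrite A2. eapply Rle_lt_trans; [|exact Hn']. apply Rmult_le_compat_r; unfold S; lra.
    - rewrite A3. eapply Rle_lt_trans; [|exact Hn']. apply Rmult_le_compat_r; unfold S; lra. }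
  rewrite A2, A3 in B'.
  replace ((b - a) * (1 / 2) ^ n + (d - c) * (1 / 2) ^ n) with (S * (1 / 2) ^ n) in B' by (unfold S; ring).
  rewrite Rpow_mult_distr, <- pow_mult, Nat.mul_comm, pow_mult in B'.
  replace ((1 / 2) ^ 2) with (1 / 4) in B' by field.
  assert (P4 : 0 < (1 / 4) ^ n) by (apply pow_lt; lra).
  assert (F : Cmod (Phi a b c d) <= eps * S ^ 2).
  { apply Rmult_le_reg_r with ((1 / 4) ^ n); auto. rewrite Rmult_assoc. lra. }
  assert (G : eps * (S ^ 2 + 1) = Cmod (Phi a b c d)) by (unfold eps; field; lra).
  lra.
Qed.

(** * Calculus of complex-valued functions of a real variable *)

Definition rcont (f : R -> C) (t : R) : Prop :=
  forall eps, 0 < eps -> exists d, 0 < d /\ forall s, Rabs (s - t) < d -> Cmod (f s - f t) < eps.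

Definition rdiff (f : R -> C) (t : R) (l : C) : Prop :=
  forall eps, 0 < eps -> exists d, 0 < d /\ forall s, Rabs (s - t) < d ->
    Cmod (f s - f t - RtoC (s - t) * l) <= eps * Rabs (s - t).

Definition cint (f : R -> C) (a b : R) : C := @RInt C_R_CompleteNormedModule f a b.

Definition cintegrable (f : R -> C) (a b : R) : Prop := @ex_RInt C_R_NormedModule f a b.

Lemma rcont_continuous f t : rcont f t -> @continuous R_UniformSpace C_R_NormedModule f t.
Proof.
  intros H. refine (proj2 (filterlim_locally (U := C_R_NormedModule) f (f t)) _). intros eps.
  destruct (H eps (cond_pos eps)) as [d [Hd Hs]].
  exists (mkposreal d Hd). intros s Hb.
  apply C_NormedModule_mixin_compat1. apply Hs. exact Hb.
Qed.

Lemma rdiff_is_derive f t l : rdiff f t l -> @is_derive R_AbsRing C_R_NormedModule f t l.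
Proof.
  intros H; split; [apply is_linear_scal_l|].
  intros x Hx.
  assert (E : t = x) by (apply (is_filter_lim_locally_unique (V := R_NormedModule)); exact Hx).
  rewrite <- E. intros eps.
  destruct (H eps (cond_pos eps)) as [d [Hd Hs]].
  exists (mkposreal d Hd). intros s Hb. specialize (Hs s Hb).
  change (@norm R_AbsRing C_R_NormedModule ((f s - f t) - @scal R_AbsRing C_R_NormedModule (s - t)%R l)%C <= eps * Rabs (s - t)%R).
  rewrite <- Cmod_norm.
  eapply Rle_trans; [|exact Hs]. apply Req_le. f_equal. f_equal.
  apply injective_projections; simpl; unfold scal; simpl; unfold mult; simpl; ring.
Qed.

Lemma cintegrable_cont f a b : a <= b -> (forall t, a <= t <= b -> rcont f t) -> cintegrable f a b.
Proof.
  intros Hab H. apply (@ex_RInt_continuous C_R_CompleteNormedModule). intros t Ht.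
  rewrite Rmin_left, Rmax_right in Ht by lra. now apply rcont_continuous, H.
Qed.

Lemma cint_ext f g a b : a <= b -> (forall t, a <= t <= b -> f t = g t) -> cint f a b = cint g a b.
Proof.
  intros Hab H. apply (RInt_ext (V := C_R_CompleteNormedModule)). rewrite Rmin_left, Rmax_right by lra. intros; apply H; lra.
Qed.

Lemma cint_Chasles f a b c : cintegrable f a b -> cintegrable f b c ->
  (cint f a c = cint f a b + cint f b c)%C.
Proof. intros H1 H2. symmetry. exact (RInt_Chasles (V := C_R_CompleteNormedModule) f a b c H1 H2). Qed.

Lemma cint_plus f g a b : cintegrable f a b -> cintegrable g a b ->
  (cint (fun t => f t + g t) a b = cint f a b + cint g a b)%C.
Proof. intros H1 H2. exact (RInt_plus (V := C_R_CompleteNormedModule) f g a b H1 H2). Qed.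

Lemma cint_minus f g a b : cintegrable f a b -> cintegrable g a b ->
  (cint (fun t => f t - g t) a b = cint f a b - cint g a b)%C.
Proof. intros H1 H2. exact (RInt_minus (V := C_R_CompleteNormedModule) f g a b H1 H2). Qed.

(** The module structure behind [cint] is over the reals, so linearity in a complex factor is read
    off from real and imaginary parts. *)
Lemma cint_scal (c : C) f a b : cintegrable f a b ->
  cintegrable (fun t => c * f t)%C a b /\ (cint (fun t => c * f t) a b = c * cint f a b)%C.
Proof.
  intros H. assert (H' := RInt_correct (V := C_R_CompleteNormedModule) f a b H).
  assert (H1 := @is_RInt_fct_extend_fst R_NormedModule R_NormedModule f a b _ H').
  assert (H2 := @is_RInt_fct_extend_snd R_NormedModule R_NormedModule f a b _ H').
  assert (G : @is_RInt C_R_NormedModule (fun t => c * f t)%C a b (c * cint f a b)%C).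
  { apply (@is_RInt_fct_extend_pair R_NormedModule R_NormedModule).
    - apply (is_RInt_minus (V := R_NormedModule)); apply (is_RInt_scal (V := R_NormedModule)); assumption.
    - apply (is_RInt_plus (V := R_NormedModule)); apply (is_RInt_scal (V := R_NormedModule)); assumption. }
  split; [eexists; exact G|]. exact (is_RInt_unique (V := C_R_CompleteNormedModule) _ _ _ _ G).
Qed.

Lemma cint_bound f a b M : a <= b -> cintegrable f a b ->
  (forall t, a <= t <= b -> Cmod (f t) <= M) -> Cmod (cint f a b) <= (b - a) * M.
Proof.
  intros Hab H HM. rewrite Cmod_norm.
  refine (norm_RInt_le_const (V := C_R_NormedModule) f a b _ M Hab _ _).
  { intros t Ht. rewrite <- Cmod_norm. now apply HM. }
  exact (RInt_correct (V := C_R_CompleteNormedModule) f a b H).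
Qed.

Lemma cint_derive (F f : R -> C) a b : a <= b ->
  (forall t, a <= t <= b -> rdiff F t (f t)) -> (forall t, a <= t <= b -> rcont f t) ->
  cint f a b = (F b - F a)%C.
Proof.
  intros Hab HF Hf.
  apply (is_RInt_unique (V := C_R_CompleteNormedModule)).
  apply (is_RInt_derive (V := C_R_CompleteNormedModule) F f a b);
    rewrite Rmin_left, Rmax_right by lra; intros t Ht.
  - now apply rdiff_is_derive, HF.
  - now apply rcont_continuous, Hf.
Qed.

(** * Goursat's theorem on polar rectangles *)

Lemma rdiff_rcont f t l : rdiff f t l -> rcont f t.
Proof.
  intros H eps Heps.
  destruct (H 1 Rlt_0_1) as [d [Hd Hs]].
  assert (Pl := Cmod_ge_0 l).
  exists (Rmin d (eps / (1 + Cmod l))); split.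
  - apply Rmin_pos; auto. apply Rdiv_lt_0_compat; lra.
  - intros s H1.
    assert (H2 : Rabs (s - t) < d) by (eapply Rlt_le_trans; [exact H1|apply Rmin_l]).
    assert (H3 : Rabs (s - t) < eps / (1 + Cmod l)) by (eapply Rlt_le_trans; [exact H1|apply Rmin_r]).
    specialize (Hs s H2).
    replace (f s - f t)%C with ((f s - f t - RtoC (s - t) * l) + RtoC (s - t) * l)%C by ring.
    eapply Rle_lt_trans; [apply Cmod_triangle|].
    rewrite Cmod_mult, Cmod_R.
    apply Rle_lt_trans with ((1 + Cmod l) * Rabs (s - t)); [lra|].
    apply Rmult_lt_compat_l with (r := 1 + Cmod l) in H3; [|lra].
    replace ((1 + Cmod l) * (eps / (1 + Cmod l))) with eps in H3 by (field; lra).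
    exact H3.
Qed.

Lemma rcont_const c t : rcont (fun _ => c) t.
Proof.
  intros eps Heps. exists 1; split; [lra|]. intros s _.
  replace (c - c)%C with (RtoC 0) by ring. now rewrite Cmod_0.
Qed.

Lemma rcont_comp (k : C -> C) (g : R -> C) t : ccont k (g t) -> rcont g t -> rcont (fun s => k (g s)) t.
Proof.
  intros Hk Hg eps Heps.
  destruct (Hk eps Heps) as [d [Hd H1]]. destruct (Hg d Hd) as [d' [Hd' H2]].
  exists d'; split; auto.
Qed.

Lemma rcont_mult f g t : rcont f t -> rcont g t -> rcont (fun s => f s * g s)%C t.
Proof.
  intros Hf Hg eps Heps.
  assert (P1 := Cmod_ge_0 (f t)). assert (P2 := Cmod_ge_0 (g t)).
  set (A := 1 + Cmod (f t) + Cmod (g t)).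
  set (e := Rmin 1 (eps / (2 * A))).
  assert (He' : 0 < eps / (2 * A)) by (apply Rdiv_lt_0_compat; unfold A; lra).
  assert (He : 0 < e) by (unfold e; apply Rmin_pos; lra).
  destruct (Hf e He) as [d1 [Hd1 H1]]. destruct (Hg e He) as [d2 [Hd2 H2]].
  exists (Rmin d1 d2); split; [now apply Rmin_pos|].
  intros s Hs.
  assert (A1 := H1 s (Rlt_le_trans _ _ _ Hs (Rmin_l _ _))).
  assert (A2 := H2 s (Rlt_le_trans _ _ _ Hs (Rmin_r _ _))).
  replace (f s * g s - f t * g t)%C
    with ((f s - f t) * (g s - g t) + (f s - f t) * g t + f t * (g s - g t))%C by ring.
  eapply Rle_lt_trans; [apply Cmod_triangle|].
  eapply Rle_lt_trans; [apply Rplus_le_compat_r, Cmod_triangle|].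
  rewrite !Cmod_mult.
  assert (Q1 := Cmod_ge_0 (f s - f t)). assert (Q2 := Cmod_ge_0 (g s - g t)).
  assert (E1 : e <= 1) by apply Rmin_l.
  assert (E2 : e <= eps / (2 * A)) by apply Rmin_r.
  assert (E3 : e * A <= eps / 2).
  { apply Rle_trans with (eps / (2 * A) * A); [apply Rmult_le_compat_r; [unfold A; lra|exact E2]|].
    apply Req_le. field. unfold A; lra. }
  assert (Cmod (f s - f t) * Cmod (g s - g t) <= e * 1) by (apply Rmult_le_compat; lra).
  assert (Cmod (f s - f t) * Cmod (g t) <= e * Cmod (g t)) by (apply Rmult_le_compat_r; lra).
  assert (Cmod (f t) * Cmod (g s - g t) <= Cmod (f t) * e) by (apply Rmult_le_compat_l; lra).
  unfold A in E3. lra.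
Qed.

Lemma rdiff_comp (f : C -> C) (g : R -> C) t l g' :
  cdiff f (g t) l -> rdiff g t g' -> rdiff (fun s => f (g s)) t (l * g')%C.
Proof.
  intros Hf Hg eps Heps.
  assert (Pl := Cmod_ge_0 l). assert (Pg := Cmod_ge_0 g').
  destruct (Hf (eps / (2 * (1 + Cmod g')))) as [d1 [Hd1 H1]]; [apply Rdiv_lt_0_compat; lra|].
  destruct (Hg 1 Rlt_0_1) as [d2 [Hd2 H2]].
  destruct (Hg (eps / (2 * (1 + Cmod l)))) as [d3 [Hd3 H3]]; [apply Rdiv_lt_0_compat; lra|].
  destruct (rdiff_rcont _ _ _ Hg d1 Hd1) as [d4 [Hd4 H4]].
  exists (Rmin d2 (Rmin d3 d4)); split; [repeat apply Rmin_pos; auto|].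
  intros s Hs.
  assert (A2 := H2 s (Rlt_le_trans _ _ _ Hs (Rmin_l _ _))).
  assert (Hs' := Rlt_le_trans _ _ _ Hs (Rmin_r _ _)).
  assert (A3 := H3 s (Rlt_le_trans _ _ _ Hs' (Rmin_l _ _))).
  assert (A4 := H4 s (Rlt_le_trans _ _ _ Hs' (Rmin_r _ _))).
  assert (A1 := H1 _ A4).
  assert (B : Cmod (g s - g t) <= (1 + Cmod g') * Rabs (s - t)).
  { replace (g s - g t)%C with ((g s - g t - RtoC (s - t) * g') + RtoC (s - t) * g')%C by ring.
    eapply Rle_trans; [apply Cmod_triangle|]. rewrite Cmod_mult, Cmod_R. lra. }
  replace (f (g s) - f (g t) - RtoC (s - t) * (l * g'))%C
    with ((f (g s) - f (g t) - l * (g s - g t)) + l * (g s - g t - RtoC (s - t) * g'))%C by ring.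
  eapply Rle_trans; [apply Cmod_triangle|]. rewrite Cmod_mult.
  assert (C1 : Cmod (f (g s) - f (g t) - l * (g s - g t)) <= eps / 2 * Rabs (s - t)).
  { eapply Rle_trans; [exact A1|].
    apply Rle_trans with (eps / (2 * (1 + Cmod g')) * ((1 + Cmod g') * Rabs (s - t))).
    - apply Rmult_le_compat_l; [left; apply Rdiv_lt_0_compat; lra|exact B].
    - apply Req_le. field. lra. }
  assert (C2 : Cmod l * Cmod (g s - g t - RtoC (s - t) * g') <= eps / 2 * Rabs (s - t)).
  { apply Rle_trans with ((1 + Cmod l) * (eps / (2 * (1 + Cmod l)) * Rabs (s - t))).
    - apply Rmult_le_compat; try lra. apply Cmod_ge_0.
    - apply Req_le. field. lra. }
  lra.
Qed.

Lemma Cmod_le_abs (x y : R) : Cmod (x, y) <= Rabs x + Rabs y.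
Proof.
  replace (x, y) with (RtoC x + Ci * RtoC y)%C
    by (apply injective_projections; simpl; ring).
  eapply Rle_trans; [apply Cmod_triangle|]. rewrite Cmod_mult, Cmod_Ci, !Cmod_R. lra.
Qed.

Lemma rdiff_pair (f g : R -> R) t l k : derivable_pt_lim f t l -> derivable_pt_lim g t k ->
  rdiff (fun s => (f s, g s)) t (l, k).
Proof.
  intros Hf Hg eps Heps.
  destruct (Hf (eps / 2)) as [d1 H1]; [lra|]. destruct (Hg (eps / 2)) as [d2 H2]; [lra|].
  assert (A : forall (f : R -> R) l d s, (forall h, h <> 0 -> Rabs h < d ->
      Rabs ((f (t + h) - f t) / h - l) < eps / 2) -> Rabs (s - t) < d ->
      Rabs (f s - f t - (s - t) * l) <= eps / 2 * Rabs (s - t)).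
  { clear. intros f l d s H Hs.
    destruct (Req_dec (s - t) 0) as [E|E].
    - rewrite E. replace s with t by lra.
      replace (f t - f t - 0 * l) with 0 by ring. rewrite Rabs_R0. lra.
    - specialize (H (s - t) E Hs). replace (t + (s - t)) with s in H by ring.
      replace (f s - f t - (s - t) * l) with (((f s - f t) / (s - t) - l) * (s - t)) by (field; auto).
      rewrite Rabs_mult. apply Rmult_le_compat_r; [apply Rabs_pos|lra]. }
  exists (Rmin d1 d2); split; [apply Rmin_pos; apply cond_pos|].
  intros s Hs.
  assert (A1 := A f l d1 s H1 (Rlt_le_trans _ _ _ Hs (Rmin_l _ _))).
  assert (A2 := A g k d2 s H2 (Rlt_le_trans _ _ _ Hs (Rmin_r _ _))).
  replace ((f s, g s) - (f t, g t) - RtoC (s - t) * (l, k))%C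
    with (f s - f t - (s - t) * l, g s - g t - (s - t) * k)
    by (apply injective_projections; simpl; ring).
  eapply Rle_trans; [apply Cmod_le_abs|]. lra.
Qed.

(** Meant for [ks] the affine approximation of [k] at a point. The integral of [ks] along a path
    depends only on the endpoints, so around a closed contour these contributions cancel and only
    the errors, eta times the length, survive. *)
Lemma cint_near_exact (k ks P : C -> C) (g g' : R -> C) (a b eta : R) : a <= b ->
  (forall t, a <= t <= b -> rdiff g t (g' t)) ->
  (forall t, a <= t <= b -> rcont g' t) ->
  (forall t, a <= t <= b -> Cmod (g' t) <= 1) ->
  (forall t, a <= t <= b -> ccont k (g t)) ->
  (forall z, cdiff P z (ks z)) -> (forall z, ccont ks z) ->
  (forall t, a <= t <= b -> Cmod (k (g t) - ks (g t)) <= eta) ->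
  Cmod (cint (fun t => k (g t) * g' t)%C a b - (P (g b) - P (g a))) <= (b - a) * eta.
Proof.
  intros Hab Hg Hg' Hb Hk HP Hks He.
  assert (Cg : forall t, a <= t <= b -> rcont g t) by (intros; eapply rdiff_rcont; eauto).
  assert (C1 : forall t, a <= t <= b -> rcont (fun t => k (g t) * g' t)%C t)
    by (intros; apply rcont_mult; auto; apply rcont_comp; auto).
  assert (C2 : forall t, a <= t <= b -> rcont (fun t => ks (g t) * g' t)%C t)
    by (intros; apply rcont_mult; auto; apply rcont_comp; auto).
  assert (I1 := cintegrable_cont _ a b Hab C1). assert (I2 := cintegrable_cont _ a b Hab C2).
  rewrite <- (cint_derive (fun t => P (g t)) (fun t => ks (g t) * g' t)%C a b Hab); auto.
  - rewrite <- cint_minus by auto.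
    apply cint_bound; auto.
    + apply (ex_RInt_minus (V := C_R_NormedModule)); auto.
    + intros t Ht. replace (k (g t) * g' t - ks (g t) * g' t)%C with ((k (g t) - ks (g t)) * g' t)%C by ring.
      rewrite Cmod_mult. rewrite <- (Rmult_1_r eta).
      apply Rmult_le_compat; auto; apply Cmod_ge_0.
  - intros t Ht. apply rdiff_comp; auto.
Qed.

(** * Polar coordinates *)

Definition cis (t : R) : C := (cos t, sin t).
Definition pol (r t : R) : C := (RtoC r * cis t)%C.

Lemma Cmod_cis t : Cmod (cis t) = 1.
Proof.
  unfold Cmod, cis; simpl. transitivity (sqrt 1); [f_equal|apply sqrt_1].
  generalize (sin2_cos2 t). unfold Rsqr. lra.
Qed.

Lemma Cmod_pol r t : 0 <= r -> Cmod (pol r t) = r.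
Proof. intros. unfold pol. rewrite Cmod_mult, Cmod_cis, Cmod_R, Rabs_pos_eq; lra. Qed.

Lemma pol_2PI r : pol r (2 * PI) = pol r 0.
Proof. unfold pol, cis. now rewrite cos_2PI, sin_2PI, cos_0, sin_0. Qed.

(** The chord has length 2 |sin((s - t) / 2)|, and |sin x| <= |x|. *)
Lemma cis_lipschitz s t : Cmod (cis s - cis t) <= Rabs (s - t).
Proof.
  assert (S : Rabs (sin ((s - t) / 2)) <= Rabs ((s - t) / 2)).
  { generalize (bounded_variation sin cos 1 0 ((s - t) / 2)).
    rewrite sin_0, !Rminus_0_r, Rmult_1_l. intros H; apply H.
    intros x _. split; [apply is_derive_sin|]. apply Rabs_le, COS_bound. }
  rewrite <- (Rabs_pos_eq (Cmod _)) by apply Cmod_ge_0.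
  apply Rsqr_le_abs_0. unfold Rsqr.
  replace (Cmod (cis s - cis t) * Cmod (cis s - cis t)) with (4 * Rsqr (sin ((s - t) / 2))).
  - apply Rsqr_le_abs_1 in S. unfold Rsqr in *. lra.
  - replace (Cmod (cis s - cis t) * Cmod (cis s - cis t)) with (Cmod (cis s - cis t) ^ 2) by ring.
    rewrite Cmod2_alt. unfold cis; simpl.
    assert (E : cos (s - t) = 1 - 2 * Rsqr (sin ((s - t) / 2))).
    { replace (s - t) with (2 * ((s - t) / 2)) at 1 by field. rewrite cos_2a_sin. unfold Rsqr; ring. }
    rewrite cos_minus in E.
    generalize (sin2_cos2 s) (sin2_cos2 t). unfold Rsqr in *. lra.
Qed.

Lemma pol_lipschitz r s r' t : 0 <= r' <= 1 ->
  Cmod (pol r s - pol r' t) <= Rabs (r - r') + Rabs (s - t).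
Proof.
  intros H.
  replace (pol r s - pol r' t)%C with (RtoC (r - r') * cis s + RtoC r' * (cis s - cis t))%C
    by (unfold pol; rewrite RtoC_minus; ring).
  eapply Rle_trans; [apply Cmod_triangle|].
  rewrite !Cmod_mult, !Cmod_R, Cmod_cis, (Rabs_pos_eq r') by lra.
  generalize (cis_lipschitz s t) (Cmod_ge_0 (cis s - cis t)). intros. nra.
Qed.

Lemma rdiff_pol_t r t : rdiff (fun t => pol r t) t (Ci * pol r t)%C.
Proof.
  replace (Ci * pol r t)%C with (- r * sin t, r * cos t)
    by (unfold pol, cis; apply injective_projections; simpl; ring).
  intros eps Heps.
  destruct (rdiff_pair (fun t => r * cos t) (fun t => r * sin t) t (- r * sin t) (r * cos t)) with (eps := eps)
    as [d [Hd H]]; auto.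
  - replace (- r * sin t) with (r * (- sin t)) by ring.
    apply derivable_pt_lim_scal, derivable_pt_lim_cos.
  - apply derivable_pt_lim_scal, derivable_pt_lim_sin.
  - exists d; split; auto. intros s Hs.
    replace (pol r s) with (r * cos s, r * sin s)
      by (unfold pol, cis; apply injective_projections; simpl; ring).
    replace (pol r t) with (r * cos t, r * sin t)
      by (unfold pol, cis; apply injective_projections; simpl; ring).
    auto.
Qed.

Lemma rdiff_pol_r r t : rdiff (fun r => pol r t) r (cis t).
Proof.
  intros eps Heps. exists 1; split; [lra|]. intros s _.
  replace (pol s t - pol r t - (s - r)%R * cis t)%C with (RtoC 0)
    by (unfold pol; rewrite RtoC_minus; ring).
  rewrite Cmod_0. apply Rmult_le_pos; [lra|apply Rabs_pos].
Qed.

Lemma rcont_pol r t : rcont (fun t => pol r t) t.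
Proof. eapply rdiff_rcont, rdiff_pol_t. Qed.

(* [Ci * circ k r] is the contour integral of [k] over [|z| = r]. *)
Definition circ (k : C -> C) (r : R) : C := cint (fun t => k (pol r t) * pol r t)%C 0 (2 * PI).

(** The boundary of [r1, r2] x [0, 2 PI] maps to the two circles and to one segment run through in
    both directions, at t = 0 and at t = 2 PI. The bound [r2 <= 1] keeps both partial derivatives of
    [pol] at modulus at most 1. *)
Lemma goursat (k : C -> C) (r1 r2 : R) : 0 <= r1 -> r1 <= r2 -> r2 <= 1 ->
  (forall r t, r1 <= r <= r2 -> exists l, cdiff k (pol r t) l) ->
  circ k r1 = circ k r2.
Proof.
  intros H0 H12 H1 Hk.
  assert (HPI := PI_RGT_0).
  assert (Kc : forall r t, r1 <= r <= r2 -> ccont k (pol r t)).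
  { intros r t Hr. destruct (Hk r t Hr) as [l Hl]. eapply cdiff_ccont; eauto. }
  set (A := fun t r => (k (pol r t) * cis t)%C).
  set (B := fun r t => (k (pol r t) * (Ci * pol r t))%C).
  assert (IA : forall t a b, r1 <= a -> a <= b -> b <= r2 -> cintegrable (A t) a b).
  { intros t a b Ha Hab Hb. apply cintegrable_cont; auto. intros r Hr.
    apply rcont_mult; [|apply rcont_const].
    apply (rcont_comp k (fun r => pol r t)); [apply Kc; lra|eapply rdiff_rcont, rdiff_pol_r]. }
  assert (IB : forall r a b, r1 <= r <= r2 -> a <= b -> cintegrable (B r) a b).
  { intros r a b Hr Hab. apply cintegrable_cont; auto. intros t Ht.
    apply rcont_mult; [|apply rcont_mult; [apply rcont_const|apply rcont_pol]].
    apply (rcont_comp k (fun t => pol r t)); [apply Kc; lra|apply rcont_pol]. }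
  set (Phi := fun a b c d => (cint (A c) a b + cint (B b) c d - cint (A d) a b - cint (B a) c d)%C).
  assert (Z : Phi r1 r2 0 (2 * PI) = RtoC 0).
  { apply bisection_zero; try lra.
    - intros a x b c d ? ? ? ? ? ? ?. unfold Phi.
      rewrite (cint_Chasles (A c) a x b), (cint_Chasles (A d) a x b) by (apply IA; lra). ring.
    - intros a b c y d ? ? ? ? ? ? ?. unfold Phi.
      rewrite (cint_Chasles (B a) c y d), (cint_Chasles (B b) c y d) by (apply IB; lra). ring.
    - intros x y eps Hx Hy Heps.
      destruct (Hk x y Hx) as [l Hl].
      (* The perimeter in the parameter plane is 2 S and the error on it at most (eps / 2) S, in
         total eps S^2. Sides shorter than d0 / 2 give S < d0. *)
      destruct (Hl (eps / 2)) as [d0 [Hd0 Hw]]; [lra|].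
      exists (d0 / 2); split; [lra|].
      intros a b c d Ha Hax Hb Hc Hcy Hd Hba Hdc.
      set (S := b - a + (d - c)).
      set (z := pol x y).
      set (ks := fun w => (k z + l * (w - z))%C).
      set (P := fun w => (k z * w + l * (/ 2 * (w * w) + (- z) * w))%C).
      assert (HP : forall w, cdiff P w (ks w)).
      { intros w. unfold P, ks.
        replace (k z + l * (w - z))%C with
          (k z * 1 + l * (/ 2 * (1 * w + w * 1) + - z * 1))%C by field.
        assert (D := cdiff_id w).
        apply cdiff_plus; apply cdiff_cmult; [exact D|].
        apply cdiff_plus; apply cdiff_cmult; [|exact D].
        exact (cdiff_mult _ _ _ _ _ D D). }
      assert (Hks : forall w, ccont ks w).
      { intros w. apply ccont_plus; [apply ccont_const|].
        apply ccont_mult; [apply ccont_const|].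
        apply (ccont_plus (fun w => w) (fun _ => - z)%C); [apply ccont_id|apply ccont_const]. }
      assert (HS : 0 <= S) by (unfold S; lra).
      assert (Err : forall r t, a <= r <= b -> c <= t <= d -> Cmod (k (pol r t) - ks (pol r t)) <= eps / 2 * S).
      { intros r t Hr Ht.
        assert (L : Cmod (pol r t - z) <= S).
        { eapply Rle_trans; [apply pol_lipschitz; lra|].
          unfold S. apply Rplus_le_compat; apply Rabs_le; lra. }
        unfold ks. replace (k (pol r t) - (k z + l * (pol r t - z)))%C
          with (k (pol r t) - k z - l * (pol r t - z))%C by ring.
        eapply Rle_trans; [apply Hw; fold z; unfold S in L; lra|].
        apply Rmult_le_compat_l; [lra|exact L]. }
      assert (EA : forall t, c <= t <= d -> Cmod (cint (A t) a b - (P (pol b t) - P (pol a t))) <= (b - a) * (eps / 2 * S)).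
      { intros t Ht. apply (cint_near_exact k ks P (fun r => pol r t) (fun _ => cis t)); auto; try lra.
        - intros r _. apply rdiff_pol_r.
        - intros r _. apply rcont_const.
        - intros r _. rewrite Cmod_cis; lra.
        - intros r Hr. apply Kc; lra. }
      assert (EB : forall r, a <= r <= b -> Cmod (cint (B r) c d - (P (pol r d) - P (pol r c))) <= (d - c) * (eps / 2 * S)).
      { intros r Hr. apply (cint_near_exact k ks P (fun t => pol r t) (fun t => Ci * pol r t)%C); auto; try lra.
        - intros t _. apply rdiff_pol_t.
        - intros t _. apply rcont_mult; [apply rcont_const|apply rcont_pol].
        - intros t _. rewrite Cmod_mult, Cmod_Ci, Cmod_pol; lra.
        - intros t Ht. apply Kc; lra. }
      assert (E1 := EA c ltac:(lra)). assert (E2 := EB b ltac:(lra)).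
      assert (E3 := EA d ltac:(lra)). assert (E4 := EB a ltac:(lra)).
      replace (Phi a b c d) with
        ((cint (A c) a b - (P (pol b c) - P (pol a c))) + (cint (B b) c d - (P (pol b d) - P (pol b c)))
         - (cint (A d) a b - (P (pol b d) - P (pol a d))) - (cint (B a) c d - (P (pol a d) - P (pol a c))))%C
        by (unfold Phi; ring).
      eapply Rle_trans; [apply Cmod_minus_le|].
      eapply Rle_trans; [apply Rplus_le_compat_r, Cmod_minus_le|].
      eapply Rle_trans; [apply Rplus_le_compat_r, Rplus_le_compat_r, Cmod_triangle|].
      fold S. replace (eps * S ^ 2) with
        ((b - a) * (eps / 2 * S) + (d - c) * (eps / 2 * S) + (b - a) * (eps / 2 * S) + (d - c) * (eps / 2 * S))
        by (unfold S; field).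
      lra. }
  unfold Phi in Z.
  assert (EA : cint (A 0) r1 r2 = cint (A (2 * PI)) r1 r2).
  { apply cint_ext; auto. intros t _. unfold A. rewrite pol_2PI. unfold cis.
    now rewrite cos_2PI, sin_2PI, cos_0, sin_0. }
  assert (EB : forall r, r1 <= r <= r2 -> cint (B r) 0 (2 * PI) = (Ci * circ k r)%C).
  { intros r Hr. unfold circ.
    rewrite <- (proj2 (cint_scal Ci (fun t => k (pol r t) * pol r t)%C 0 (2 * PI) ltac:(
      apply cintegrable_cont; [lra|]; intros t _; apply rcont_mult; [|apply rcont_pol];
      apply (rcont_comp k (fun t => pol r t)); [apply Kc; lra|apply rcont_pol]))).
    apply cint_ext; [lra|]. intros t _. unfold B. ring. }
  rewrite EA, !EB in Z by lra.
  replace (circ k r1) with (circ k r2 + Ci * (cint (A (2 * PI)%R) r1 r2 + Ci * circ k r2 - cint (A (2 * PI)%R) r1 r2 - Ci * circ k r1))%C;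
    [rewrite Z; ring|].
  apply injective_projections; simpl; ring.
Qed.

(** * Cauchy's formula and estimates *)

Lemma cint_circ_integrable k r : 0 <= r -> (forall z, Cmod z = r -> ccont k z) ->
  cintegrable (fun t => k (pol r t) * pol r t)%C 0 (2 * PI).
Proof.
  intros Hr Hk. assert (HPI := PI_RGT_0).
  apply cintegrable_cont; [lra|]. intros t _. apply rcont_mult; [|apply rcont_pol].
  apply (rcont_comp k (fun t => pol r t)); [apply Hk, Cmod_pol, Hr|apply rcont_pol].
Qed.

Lemma circ_continuous (k : C -> C) r0 eps : (forall z, inD z -> ccont k z) ->
  0 <= r0 < 1 -> 0 < eps ->
  exists d, 0 < d /\ forall r, 0 <= r < 1 -> Rabs (r - r0) < d -> Cmod (circ k r - circ k r0) <= eps.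
Proof.
  intros Hk Hr0 Heps. assert (HPI := PI_RGT_0).
  set (H := fun z => (k z * z)%C).
  assert (HH : forall z, inD z -> ccont H z).
  { intros z Hz. apply ccont_mult; [auto|apply ccont_id]. }
  (* The integrand will change by at most 2 e over a parameter interval of length 2 PI. *)
  set (e := eps / (4 * PI)).
  assert (He : 0 < e) by (apply Rdiv_lt_0_compat; lra).
  (* Uniform continuity by a gauge on the circle. The factor 2 lets one [d] pay for the step from
     [t] to its tag and another for the step from [r0] to [r]. *)
  assert (Ex : forall t, exists d : posreal, forall w, Cmod (w - pol r0 t) < 2 * d -> Cmod (H w - H (pol r0 t)) < e).
  { intros t. destruct (HH (pol r0 t)) with (eps := e) as [d [Hd Hw]]; auto.
    { unfold inD. rewrite Cmod_pol; lra. }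
    assert (Hd2 : 0 < d / 2) by lra. exists (mkposreal _ Hd2). simpl. intros w Hw'. apply Hw. lra. }
  set (delta := fun t => proj1_sig (constructive_indefinite_description _ (Ex t))).
  assert (Hdelta : forall t w, Cmod (w - pol r0 t) < 2 * delta t -> Cmod (H w - H (pol r0 t)) < e).
  { intros t. exact (proj2_sig (constructive_indefinite_description _ (Ex t))). }
  destruct (compactness_value_1d 0 (2 * PI) delta) as [d Hd].
  exists d; split; [apply cond_pos|].
  intros r Hr Hrd.
  unfold circ. rewrite <- cint_minus.
  - replace eps with ((2 * PI - 0) * (2 * e)) by (unfold e; field; lra).
    apply cint_bound; [lra| |].
    + apply (ex_RInt_minus (V := C_R_NormedModule));
        apply cint_circ_integrable; try lra; intros z Hz; apply Hk; unfold inD; lra.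
    + intros t Ht. apply NNPP. intros Hn. apply (Hd t Ht). intros [s [Hs [Hts Hds]]].
      apply Hn. clear Hn.
      change (Cmod (H (pol r t) - H (pol r0 t)) <= 2 * e).
      replace (H (pol r t) - H (pol r0 t))%C with ((H (pol r t) - H (pol r0 s)) - (H (pol r0 t) - H (pol r0 s)))%C by ring.
      eapply Rle_trans; [apply Cmod_minus_le|].
      assert (A1 : Cmod (H (pol r t) - H (pol r0 s)) < e).
      { apply Hdelta. eapply Rle_lt_trans; [apply pol_lipschitz; lra|]. lra. }
      assert (A2 : Cmod (H (pol r0 t) - H (pol r0 s)) < e).
      { apply Hdelta. eapply Rle_lt_trans; [apply pol_lipschitz; lra|].
        replace (r0 - r0) with 0 by ring. rewrite Rabs_R0. generalize (cond_pos (delta s)); lra. }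
      lra.
  - apply cint_circ_integrable; [lra|]. intros z Hz; apply Hk; unfold inD; lra.
  - apply cint_circ_integrable; [lra|]. intros z Hz; apply Hk; unfold inD; lra.
Qed.

Lemma circ_0 k : circ k 0 = RtoC 0.
Proof.
  assert (HPI := PI_RGT_0). unfold circ.
  rewrite (cint_ext _ (fun _ => RtoC 0)) by (try lra; intros; unfold pol; ring).
  apply Cmod_small_eq_0. intros e He.
  eapply Rle_trans; [apply cint_bound with (M := 0); [lra| |]|lra].
  - apply cintegrable_cont; [lra|]. intros; apply rcont_const.
  - intros. rewrite Cmod_0; lra.
Qed.

(** Made for a difference quotient, which is continuous on the disc but not known to be
    differentiable at one point. The whole circle through that point is left out: [circ k] is
    constant on either side of [r0], continuous across [r0], and 0 at radius 0. *)
Lemma circ_zero (k : C -> C) r0 r : (forall z, inD z -> ccont k z) -> 0 <= r0 ->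
  (forall z, inD z -> Cmod z <> r0 -> exists l, cdiff k z l) ->
  r0 < r < 1 -> circ k r = RtoC 0.
Proof.
  intros Hc H0 Hk Hr.
  assert (E0 : circ k r0 = RtoC 0).
  { destruct (Req_dec r0 0) as [E|E]; [rewrite E; apply circ_0|].
    apply Cmod_small_eq_0. intros e He.
    destruct (circ_continuous k r0 e Hc) as [d [Hd Hw]]; try lra.
    set (s := Rmax 0 (r0 - d / 2)).
    assert (Hs : 0 <= s < r0) by (unfold s; split; [apply Rmax_l|apply Rmax_lub_lt; lra]).
    assert (Hs' : r0 - d / 2 <= s) by apply Rmax_r.
    assert (G : circ k 0 = circ k s).
    { apply goursat; try lra. intros r' t Hr'. apply Hk; unfold inD; rewrite Cmod_pol; lra. }
    rewrite circ_0 in G.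
    replace (circ k r0) with (- (circ k s - circ k r0))%C by (rewrite <- G; ring).
    rewrite Cmod_opp. apply Hw; [lra|]. apply Rabs_def1; lra. }
  apply Cmod_small_eq_0. intros e He.
  destruct (circ_continuous k r0 e Hc) as [d [Hd Hw]]; try lra.
  set (s := Rmin r (r0 + d / 2)).
  assert (Hs : r0 < s <= r) by (unfold s; split; [apply Rmin_glb_lt; lra|apply Rmin_l]).
  assert (Hs' : s <= r0 + d / 2) by apply Rmin_r.
  assert (G : circ k s = circ k r).
  { apply goursat; try lra. intros r' t Hr'. apply Hk; unfold inD; rewrite Cmod_pol; lra. }
  replace (circ k r) with (circ k s - circ k r0)%C by (rewrite E0, G; ring).
  apply Hw; [lra|]. apply Rabs_def1; lra.
Qed.

Fixpoint csum (a : nat -> C) (n : nat) : C :=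
  match n with O => RtoC 0 | S n => (csum a n + a n)%C end.

Lemma cdiff_pow n z : cdiff (fun w => w ^ S n)%C z (RtoC (INR (S n)) * z ^ n)%C.
Proof.
  induction n.
  - apply cdiff_ext_loc with (f := fun w => w) (d := 1); [lra|intros; simpl; ring|].
    replace (RtoC (INR 1) * z ^ 0)%C with (RtoC 1) by (simpl; ring). apply cdiff_id.
  - replace (RtoC (INR (S (S n))) * z ^ S n)%C
      with (1 * z ^ S n + z * (RtoC (INR (S n)) * z ^ n))%C
      by (rewrite (S_INR (S n)), RtoC_plus, (Cpow_S z n); ring).
    apply (cdiff_mult (fun w => w) (fun w => w ^ S n)%C); [apply cdiff_id|exact IHn].
Qed.

Lemma circ_inv_pow n r : 0 < r -> circ (fun z => / z ^ S (S n))%C r = RtoC 0.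
Proof.
  intros Hr. assert (HPI := PI_RGT_0).
  assert (Nz : forall t, pol r t <> RtoC 0).
  { intros t. apply Cmod_gt_0. rewrite Cmod_pol; lra. }
  assert (Nn : RtoC (INR (S n)) <> RtoC 0).
  { intros E. apply RtoC_inj in E. generalize (S_INR n) (pos_INR n). lra. }
  unfold circ.
  (* A single-valued primitive closes up along the circle. Since [circ] omits the factor i of dz,
     the primitive -z^(-(n+1)) / (n+1) must be divided by i, which gives i / (n+1). *)
  set (c := (Ci * / RtoC (INR (S n)))%C).
  rewrite (cint_derive (fun t => c * / (pol r t) ^ S n)%C).
  - rewrite pol_2PI. ring.
  - lra.
  - intros t _.
    assert (D := cdiff_cmult c _ _ _ (cdiff_inv _ _ _ (cdiff_pow n (pol r t)) (Cpow_nz _ _ (Nz t)))).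
    assert (D' := rdiff_comp _ (fun t => pol r t) t _ _ D (rdiff_pol_t r t)).
    match type of D' with rdiff _ _ ?l =>
      replace (/ pol r t ^ S (S n) * pol r t)%C with l; [exact D'|] end.
    unfold c. rewrite !Cpow_S. assert (P := Cpow_nz _ n (Nz t)).
    assert (I2 : (Ci * Ci = - 1)%C) by (apply injective_projections; simpl; ring).
    transitivity (- (Ci * Ci) * / (pol r t * pol r t ^ n))%C.
    { field; repeat split; auto. }
    rewrite I2. field; repeat split; auto.
  - intros t _. apply rcont_mult; [|apply rcont_pol].
    apply (rcont_comp (fun z => / z ^ S (S n))%C (fun t => pol r t)); [|apply rcont_pol].
    apply ccont_inv; [|apply Cpow_nz, Nz]. eapply cdiff_ccont, cdiff_pow.
Qed.

Lemma rcont_bounded g a b : a <= b -> (forall t, a <= t <= b -> rcont g t) ->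
  exists M, forall t, a <= t <= b -> Cmod (g t) <= M.
Proof.
  intros Hab Hg.
  destruct (continuity_ab_maj (fun t => Cmod (g t)) a b Hab) as [x [Hx _]].
  - intros t Ht eps Heps. destruct (Hg t Ht eps Heps) as [d [Hd Hs]].
    exists d; split; auto. intros s [_ Hst]. simpl in *. unfold R_dist in *.
    specialize (Hs s Hst).
    generalize (Cmod_triangle_rev (g s) (g t)) (Cmod_triangle_rev (g t) (g s)).
    rewrite (Cmod_sub_sym (g t)). intros. apply Rabs_def1; lra.
  - exists (Cmod (g x)). auto.
Qed.

Lemma Hol_slope (f : C -> C) z0 : Hol f -> inD z0 ->
  exists phi, (forall w, f w = f z0 + phi w * (w - z0))%C /\
    (forall z, inD z -> ccont phi z) /\
    (forall z, inD z -> z <> z0 -> exists l, cdiff phi z l).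
Proof.
  intros Hf Hz0. assert (Hf' := proj1 (Hol_cdiff f) Hf).
  destruct (Hf' z0 Hz0) as [l Hl].
  destruct (proj1 (cdiff_slope _ _ _) Hl) as [phi [Hphi [_ E]]].
  exists phi.
  assert (D : forall z, inD z -> z <> z0 -> exists l, cdiff phi z l).
  { intros z Hz Hn. destruct (Hf' z Hz) as [l' Hl'].
    assert (Nz : (z - z0)%C <> RtoC 0) by (intros E'; apply Hn; rewrite <- (Cplus_0_l z0), <- E'; ring).
    eexists. apply cdiff_ext_loc with (f := fun w => ((f w + - f z0) * / (w + - z0))%C) (d := Cmod (z - z0)).
    - now apply Cmod_gt_0.
    - intros w Hw. rewrite (E w). field.
      intros E'. apply (Rlt_irrefl (Cmod (z - z0))).
      replace w with z0 in Hw. { now rewrite Cmod_sub_sym in Hw. }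
      rewrite <- (Cplus_0_r z0), <- E'. ring.
    - apply cdiff_mult.
      + apply cdiff_plus; [exact Hl'|apply cdiff_const].
      + apply cdiff_inv; [apply cdiff_plus; [apply cdiff_id|apply cdiff_const]|exact Nz]. }
  repeat split; auto.
  intros z Hz. destruct (classic (z = z0)) as [->|Hn]; auto.
  destruct (D z Hz Hn) as [l' Hl']. eapply cdiff_ccont; eauto.
Qed.

(** The n-th Taylor coefficient at 0. The factor is 1 / (2 PI) because [circ] leaves out the i of
    dz, and the radius 1/2 is an arbitrary choice in (0, 1), as [cauchy_coef_eq] confirms. *)
Definition cauchy_coef (f : C -> C) (n : nat) : C :=
  (/ RtoC (2 * PI) * circ (fun z => f z * / z ^ S n) (1 / 2))%C.

Lemma RtoC_2PI_neq0 : RtoC (2 * PI) <> RtoC 0.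
Proof. intros E. apply RtoC_inj in E. generalize PI_RGT_0. lra. Qed.

Lemma cauchy_coef_eq f n r : Hol f -> 0 < r < 1 ->
  circ (fun z => f z * / z ^ S n)%C r = (RtoC (2 * PI) * cauchy_coef f n)%C.
Proof.
  intros Hf Hr. assert (Hf' := proj1 (Hol_cdiff f) Hf).
  unfold cauchy_coef.
  assert (D : forall r t, 0 < r < 1 -> exists l, cdiff (fun z => f z * / z ^ S n)%C (pol r t) l).
  { intros r' t Hr'. destruct (Hf' (pol r' t)) as [l Hl]; [unfold inD; rewrite Cmod_pol; lra|].
    eexists. apply cdiff_mult; [exact Hl|]. apply cdiff_inv; [apply cdiff_pow|].
    apply Cpow_nz, Cmod_gt_0. rewrite Cmod_pol; lra. }
  assert (E : circ (fun z => f z * / z ^ S n)%C r = circ (fun z => f z * / z ^ S n)%C (1 / 2)).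
  { destruct (Rle_dec r (1 / 2)).
    - apply goursat; try lra. intros; apply D; lra.
    - symmetry. apply goursat; try lra. intros; apply D; lra. }
  rewrite E. field. apply RtoC_2PI_neq0.
Qed.

Lemma cauchy_estimate f rho M n : Hol f -> 0 < rho < 1 ->
  (forall t, 0 <= t <= 2 * PI -> Cmod (f (pol rho t)) <= M) -> Cmod (cauchy_coef f n) * rho ^ n <= M.
Proof.
  intros Hf Hr HM. assert (HPI := PI_RGT_0).
  assert (Hc : forall z, Cmod z = rho -> ccont (fun z => f z * / z ^ S n)%C z).
  { intros z Hz. destruct (proj1 (Hol_cdiff f) Hf z) as [l Hl]; [unfold inD; lra|].
    apply ccont_mult; [eapply cdiff_ccont; eauto|]. apply ccont_inv; [eapply cdiff_ccont, cdiff_pow|].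
    apply Cpow_nz, Cmod_gt_0. lra. }
  assert (Pn : 0 < rho ^ n) by (apply pow_lt; lra).
  assert (B : Cmod (circ (fun z => f z * / z ^ S n)%C rho) <= (2 * PI - 0) * (M / rho ^ n)).
  { unfold circ. apply cint_bound; [lra|apply (cint_circ_integrable (fun z => f z * / z ^ S n)%C); [lra|exact Hc]|].
    intros t Ht. assert (Ep := Cmod_pol rho t).
    assert (Np : pol rho t <> RtoC 0) by (apply Cmod_gt_0; lra).
    rewrite !Cmod_mult, Cmod_inv, Cmod_pow by (now apply Cpow_nz). rewrite Ep by lra.
    replace (Cmod (f (pol rho t)) * / rho ^ S n * rho) with (Cmod (f (pol rho t)) / rho ^ n)
      by (simpl; field; lra).
    apply Rmult_le_compat_r; [left; now apply Rinv_0_lt_compat|]. now apply HM. }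
  rewrite cauchy_coef_eq in B by auto.
  rewrite Cmod_mult, Cmod_R, Rabs_pos_eq in B by lra.
  assert (B' : Cmod (cauchy_coef f n) <= M / rho ^ n).
  { apply Rmult_le_reg_l with (2 * PI); lra. }
  apply Rmult_le_compat_r with (r := rho ^ n) in B'; [|lra].
  replace (M / rho ^ n * rho ^ n) with M in B' by (field; lra). exact B'.
Qed.

(** Dividing f(z) - f(z0) = phi(z) (z - z0) by z^(N+1) and integrating gives a recursion between the
    integrals of phi / z^N and phi / z^(N+1). It starts from the integral of phi, which is 0, and
    unrolls to an exact remainder for the N-th partial sum; no series is interchanged with an
    integral. *)
Lemma cauchy_expansion f z0 rho : Hol f -> inD z0 -> Cmod z0 < rho < 1 ->
  exists K, forall N, Cmod (csum (fun n => cauchy_coef f n * z0 ^ n)%C N - f z0) <= K * (Cmod z0 / rho) ^ N.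
Proof.
  intros Hf Hz0 Hr. assert (HPI := PI_RGT_0). assert (P0 := Cmod_ge_0 z0).
  assert (Hf' := proj1 (Hol_cdiff f) Hf).
  destruct (Hol_slope f z0 Hf Hz0) as [phi [E [Hc D]]].
  assert (Z : circ phi rho = RtoC 0).
  { apply circ_zero with (Cmod z0); auto. intros z Hz Hn. apply D; auto. intros ->; now apply Hn. }
  assert (Np : forall z, Cmod z = rho -> z <> RtoC 0) by (intros z Hz; apply Cmod_gt_0; lra).
  assert (Cf : forall z, Cmod z = rho -> ccont f z).
  { intros z Hz. destruct (Hf' z) as [l Hl]; [unfold inD; lra|]. eapply cdiff_ccont; eauto. }
  assert (Cp : forall N z, Cmod z = rho -> ccont (fun z => / z ^ N)%C z).
  { intros N z Hz. apply ccont_inv; [|now apply Cpow_nz, Np].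
    destruct N; [apply (ccont_const (RtoC 1))|eapply cdiff_ccont, cdiff_pow]. }
  assert (Cphi : forall z, Cmod z = rho -> ccont phi z) by (intros; apply Hc; unfold inD; lra).
  set (I := fun N => circ (fun z => phi z * / z ^ N)%C rho).
  assert (Cnd : forall n, circ (fun z => / z ^ S n)%C rho = (if Nat.eqb n 0 then RtoC (2 * PI) else RtoC 0)).
  { intros n. destruct n; simpl Nat.eqb; cbv iota; [|apply circ_inv_pow; lra].
    unfold circ. rewrite (cint_ext _ (fun _ => RtoC 1)); [|lra|].
    - rewrite (cint_derive (fun t => RtoC t)); [rewrite <- RtoC_minus; f_equal; ring|lra| |intros; apply rcont_const].
      intros t _ eps Heps. exists 1; split; [lra|]. intros s _.
      replace (s - t - (s - t)%R * 1)%C with (RtoC 0) by (rewrite RtoC_minus; ring).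
      rewrite Cmod_0. apply Rmult_le_pos; [lra|apply Rabs_pos].
    - intros t _. rewrite Cpow_1_r. apply Cinv_l, Np, Cmod_pol; lra. }
  assert (Step : forall N, I N = (RtoC (2 * PI) * cauchy_coef f N - f z0 * circ (fun z => / z ^ S N) rho + z0 * I (S N))%C).
  { intros N. rewrite <- (cauchy_coef_eq f N rho Hf) by lra.
    assert (I1 : cintegrable (fun t => f (pol rho t) * / pol rho t ^ S N * pol rho t)%C 0 (2 * PI)).
    { apply (cint_circ_integrable (fun z => f z * / z ^ S N)%C); [lra|]. intros z Hz. apply ccont_mult; auto. }
    assert (I2 : cintegrable (fun t => / pol rho t ^ S N * pol rho t)%C 0 (2 * PI)).
    { apply (cint_circ_integrable (fun z => / z ^ S N)%C); [lra|]. intros z Hz. auto. }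
    assert (I3 : cintegrable (fun t => phi (pol rho t) * / pol rho t ^ S N * pol rho t)%C 0 (2 * PI)).
    { apply (cint_circ_integrable (fun z => phi z * / z ^ S N)%C); [lra|]. intros z Hz. apply ccont_mult; auto. }
    unfold I, circ.
    destruct (cint_scal (f z0) _ _ _ I2) as [J2 <-].
    destruct (cint_scal z0 _ _ _ I3) as [J3 <-].
    rewrite <- cint_minus by assumption.
    rewrite <- cint_plus; [|apply (ex_RInt_minus (V := C_R_NormedModule)); assumption|assumption].
    apply cint_ext; [lra|]. intros t _.
    rewrite (E (pol rho t)).
    assert (Nt : pol rho t <> RtoC 0) by (apply Np, Cmod_pol; lra).
    assert (Nt' := Cpow_nz _ N Nt).
    rewrite Cpow_S. field. auto. }
  assert (I0 : I 0%nat = RtoC 0).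
  { rewrite <- Z. unfold I, circ. apply cint_ext; [lra|]. intros t _. simpl. field.
  }
  (* The case distinction reflects that only 1/z has a nonzero circle integral: f(z0) enters at the
     first step and never again. *)
  assert (Sum : forall N, (RtoC (2 * PI) * (csum (fun n => cauchy_coef f n * z0 ^ n) N - (if Nat.eqb N 0 then 0 else f z0)) = - (z0 ^ N * I N))%C).
  { induction N.
    - rewrite I0. simpl. ring.
    - rewrite Step in IHN. rewrite Cnd in IHN.
      change (csum (fun n => cauchy_coef f n * z0 ^ n) (S N))%C
        with (csum (fun n => cauchy_coef f n * z0 ^ n) N + cauchy_coef f N * z0 ^ N)%C.
      simpl (Nat.eqb (S N) 0). cbv iota. rewrite Cpow_S.
      match goal with |- ?A = ?B => replace A with ((RtoC (2 * PI) * (csum (fun n : nat => cauchy_coef f n * z0 ^ n) N -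
         (if Nat.eqb N 0 then 0 else f z0))) + RtoC (2 * PI) * (cauchy_coef f N * z0 ^ N + (if Nat.eqb N 0 then 0 else f z0) - f z0))%C by ring end.
      rewrite IHN. destruct N; simpl Nat.eqb; cbv iota; simpl; ring. }
  destruct (rcont_bounded (fun t => phi (pol rho t) * pol rho t)%C 0 (2 * PI)) as [M HM]; [lra| |].
  { intros t _. apply rcont_mult; [|apply rcont_pol].
    apply (rcont_comp phi (fun t => pol rho t)); [apply Cphi, Cmod_pol; lra|apply rcont_pol]. }
  assert (M0 : 0 <= M) by (eapply Rle_trans; [apply Cmod_ge_0|apply (HM 0); lra]).
  (* [Cmod (f z0)] serves N = 0, where the partial sum is empty; [M] bounds the remainder for N >=
     1. *)
  exists (Cmod (f z0) + M). intros N.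
  destruct N as [|N].
  - simpl. replace (0 - f z0)%C with (- f z0)%C by ring. rewrite Cmod_opp. lra.
  - specialize (Sum (S N)). simpl (Nat.eqb (S N) 0) in Sum. cbv iota in Sum.
    set (T := (csum (fun n => cauchy_coef f n * z0 ^ n) (S N) - f z0)%C) in *.
    assert (BI : Cmod (I (S N)) <= (2 * PI - 0) * (M / rho ^ S N)).
    { unfold I, circ. apply cint_bound; [lra|apply (cint_circ_integrable (fun z => phi z * / z ^ S N)%C); [lra|]|].
      { intros z Hz. apply ccont_mult; auto. }
      intros t Ht. assert (Ep := Cmod_pol rho t).
      replace (phi (pol rho t) * / pol rho t ^ S N * pol rho t)%C
        with (phi (pol rho t) * pol rho t * / pol rho t ^ S N)%C by ring.
      rewrite Cmod_mult, Cmod_inv, Cmod_pow, Ep by (try lra; apply Cpow_nz, Np, Ep; lra).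
      apply Rmult_le_compat_r; [left; apply Rinv_0_lt_compat, pow_lt; lra|auto]. }
    assert (EC : 2 * PI * Cmod T = Cmod z0 ^ S N * Cmod (I (S N))).
    { transitivity (Cmod (RtoC (2 * PI) * T)); [rewrite Cmod_mult, Cmod_R, Rabs_pos_eq; lra|].
      now rewrite Sum, Cmod_opp, Cmod_mult, Cmod_pow. }
    assert (P1 : 0 <= Cmod z0 ^ S N) by (apply pow_le; lra).
    assert (P2 : 0 < rho ^ S N) by (apply pow_lt; lra).
    apply Rmult_le_reg_l with (2 * PI); [lra|]. rewrite EC.
    apply Rle_trans with (Cmod z0 ^ S N * ((2 * PI - 0) * (M / rho ^ S N))).
    { now apply Rmult_le_compat_l. }
    unfold Rdiv at 2. rewrite Rpow_mult_distr, pow_inv.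
    replace (Cmod z0 ^ S N * ((2 * PI - 0) * (M / rho ^ S N))) with (2 * PI * (M * (Cmod z0 ^ S N * / rho ^ S N))) by (unfold Rdiv; ring).
    apply Rmult_le_compat_l; [lra|]. apply Rmult_le_compat_r; [|generalize (Cmod_ge_0 (f z0)); lra].
    apply Rmult_le_pos; [lra|left; now apply Rinv_0_lt_compat].
Qed.

(** * Power series *)

Lemma csum_ext (a b : nat -> C) N : (forall n, (n < N)%nat -> a n = b n) -> csum a N = csum b N.
Proof.
  induction N; intros H; simpl; auto.
  rewrite IHN by auto. now rewrite H by auto.
Qed.

Lemma csum_plus a b N : csum (fun n => a n + b n)%C N = (csum a N + csum b N)%C.
Proof. induction N; simpl; [ring|]. rewrite IHN. ring. Qed.

Lemma csum_scal c a N : csum (fun n => c * a n)%C N = (c * csum a N)%C.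
Proof. induction N; simpl; [ring|]. rewrite IHN. ring. Qed.

Lemma csum_S_l a N : csum a (S N) = (a 0%nat + csum (fun n => a (S n)) N)%C.
Proof.
  induction N; [simpl; ring|].
  change (csum a (S (S N))) with (csum a (S N) + a (S N))%C. rewrite IHN. simpl. ring.
Qed.

(** The induction has to carry the exact geometric remainder, with q^n - q^(n+p) in place of q^n;
    the stated bound is not inductive. *)
Lemma csum_tail (a : nat -> C) K q : 0 <= q < 1 -> (forall n, Cmod (a n) <= K * q ^ n) ->
  forall n p, Cmod (csum a (n + p) - csum a n) <= K / (1 - q) * q ^ n.
Proof.
  intros Hq Ha n p.
  assert (HK : 0 <= K).
  { generalize (Ha 0%nat) (Cmod_ge_0 (a 0%nat)). simpl. lra. }
  assert (H : Cmod (csum a (n + p) - csum a n) <= K / (1 - q) * (q ^ n - q ^ (n + p))).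
  { induction p.
    - rewrite Nat.add_0_r. replace (csum a n - csum a n)%C with (RtoC 0) by ring. rewrite Cmod_0. lra.
    - rewrite Nat.add_succ_r. simpl csum.
      replace (csum a (n + p) + a (n + p)%nat - csum a n)%C
        with ((csum a (n + p) - csum a n) + a (n + p)%nat)%C by ring.
      eapply Rle_trans; [apply Cmod_triangle|].
      eapply Rle_trans; [apply Rplus_le_compat; [exact IHp|apply Ha]|].
      apply Req_le. simpl. field. lra. }
  eapply Rle_trans; [exact H|].
  apply Rmult_le_compat_l.
  - apply Rmult_le_pos; [lra|left; apply Rinv_0_lt_compat; lra].
  - generalize (pow_le q (n + p)). lra.
Qed.

Lemma csum_bound (a : nat -> C) K q N : 0 <= q < 1 -> (forall n, Cmod (a n) <= K * q ^ n) ->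
  Cmod (csum a N) <= K / (1 - q).
Proof.
  intros Hq Ha. generalize (csum_tail a K q Hq Ha 0 N). simpl.
  replace (csum a N - 0)%C with (csum a N) by ring. lra.
Qed.

Definition csumto (a : nat -> C) (s : C) : Prop :=
  forall eps, 0 < eps -> exists N, forall n, (N <= n)%nat -> Cmod (csum a n - s) <= eps.

(* Meaningful only for convergent series. *)
Definition cser (a : nat -> C) : C :=
  (real (Lim_seq (fun n => fst (csum a n))), real (Lim_seq (fun n => snd (csum a n)))).

Lemma geom_small K q eps : 0 <= q < 1 -> 0 < eps -> exists N, forall n, (N <= n)%nat -> K * q ^ n <= eps.
Proof.
  intros Hq Heps.
  destruct (pow_lt_1_zero q) with (y := eps / (1 + Rabs K)) as [N HN].
  - rewrite Rabs_pos_eq; lra.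
  - apply Rdiv_lt_0_compat; generalize (Rabs_pos K); lra.
  - exists N. intros n Hn. specialize (HN n Hn).
    assert (P : 0 <= q ^ n) by (apply pow_le; lra). rewrite Rabs_pos_eq in HN by auto.
    assert (PK := Rabs_pos K).
    apply Rle_trans with ((1 + Rabs K) * q ^ n).
    + apply Rmult_le_compat_r; auto. generalize (Rle_abs K); lra.
    + apply Rmult_lt_compat_l with (r := 1 + Rabs K) in HN; [|lra].
      replace ((1 + Rabs K) * (eps / (1 + Rabs K))) with eps in HN by (field; lra). lra.
Qed.

Lemma csumto_geom a s K q : 0 <= q < 1 -> (forall N, Cmod (csum a N - s) <= K * q ^ N) -> csumto a s.
Proof.
  intros Hq H eps Heps. destruct (geom_small K q eps Hq Heps) as [N HN].
  exists N. intros n Hn. eapply Rle_trans; [apply H|auto].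
Qed.

Lemma csumto_cser a s : csumto a s -> cser a = s.
Proof.
  intros H. unfold cser.
  assert (L : forall p : C -> R, (forall z, Rabs (p z) <= Cmod z) -> (forall z w, p (z - w)%C = p z - p w) ->
     Lim_seq (fun n => p (csum a n)) = Finite (p s)).
  { intros p Hp Hm. apply is_lim_seq_unique, is_lim_seq_spec. intros eps.
    destruct (H (eps / 2)) as [N HN]; [generalize (cond_pos eps); lra|].
    exists N. intros n Hn. rewrite <- Hm. eapply Rle_lt_trans; [apply Hp|].
    specialize (HN n Hn). generalize (cond_pos eps). lra. }
  assert (M := Rmax_Cmod).
  rewrite (L fst), (L snd); try reflexivity; [symmetry; apply surjective_pairing| |].
  - intros z. eapply Rle_trans; [apply Rmax_r|apply M].
  - intros z. eapply Rle_trans; [apply Rmax_l|apply M].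
Qed.

Lemma csumto_unique a s t : csumto a s -> csumto a t -> s = t.
Proof. intros H1 H2. now rewrite <- (csumto_cser a s H1), (csumto_cser a t H2). Qed.

Lemma csumto_le a s (z : C) M : csumto a s -> (forall N, exists n, (N <= n)%nat /\ Cmod (csum a n - z) <= M) -> Cmod (s - z) <= M.
Proof.
  intros H Hz. apply Rle_plus_epsilon. intros eps Heps.
  destruct (H eps Heps) as [N HN]. destruct (Hz N) as [n [Hn Hb]].
  replace (s - z)%C with ((csum a n - z) - (csum a n - s))%C by ring.
  eapply Rle_trans; [apply Cmod_minus_le|]. specialize (HN n Hn). lra.
Qed.

Lemma cser_tail a K q : 0 <= q < 1 -> (forall n, Cmod (a n) <= K * q ^ n) ->
  csumto a (cser a) /\ forall N, Cmod (csum a N - cser a) <= K / (1 - q) * q ^ N.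
Proof.
  intros Hq Ha. assert (T := csum_tail a K q Hq Ha).
  assert (Cv : forall p : C -> R, (forall z, Rabs (p z) <= Cmod z) -> (forall z w, p (z - w)%C = p z - p w) ->
     { l | Un_cv (fun n => p (csum a n)) l }).
  { intros p Hp Hm. apply Rcomplete.R_complete. intros eps Heps.
    destruct (geom_small (K / (1 - q)) q (eps / 2) Hq) as [N HN]; [lra|].
    exists N. unfold R_dist.
    assert (W : forall n m, (N <= n)%nat -> (n <= m)%nat -> Cmod (csum a m - csum a n) <= eps / 2).
    { intros n m Hn Hm'. replace m with (n + (m - n))%nat by lia. eapply Rle_trans; [apply T|auto]. }
    intros n m Hn Hm'. rewrite <- Hm. eapply Rle_lt_trans; [apply Hp|].
    destruct (Nat.le_ge_cases n m).
    - rewrite Cmod_sub_sym. assert (Cmod (csum a m - csum a n) <= eps / 2) by (apply W; lia). lra.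
    - assert (Cmod (csum a n - csum a m) <= eps / 2) by (apply W; lia). lra. }
  destruct (Cv fst) as [l1 H1].
  { intros z. eapply Rle_trans; [apply Rmax_l|apply Rmax_Cmod]. } { reflexivity. }
  destruct (Cv snd) as [l2 H2].
  { intros z. eapply Rle_trans; [apply Rmax_r|apply Rmax_Cmod]. } { reflexivity. }
  assert (S : csumto a (l1, l2)).
  { intros eps Heps. destruct (H1 (eps / 2)) as [N1 A1]; [lra|]. destruct (H2 (eps / 2)) as [N2 A2]; [lra|].
    exists (N1 + N2)%nat. intros n Hn. specialize (A1 n). specialize (A2 n). unfold R_dist in *.
    replace (csum a n - (l1, l2))%C with (fst (csum a n) - l1, snd (csum a n) - l2)
      by (apply injective_projections; simpl; ring).
    eapply Rle_trans; [apply Cmod_le_abs|].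
    assert (Rabs (fst (csum a n) - l1) < eps / 2) by (apply A1; lia).
    assert (Rabs (snd (csum a n) - l2) < eps / 2) by (apply A2; lia). lra. }
  rewrite (csumto_cser a _ S). split; auto.
  intros N. rewrite Cmod_sub_sym. apply csumto_le with (1 := S).
  intros M. exists (N + M)%nat; split; [lia|apply T].
Qed.

Lemma csumto_plus a b s t : csumto a s -> csumto b t -> csumto (fun n => a n + b n)%C (s + t)%C.
Proof.
  intros Ha Hb eps Heps.
  destruct (Ha (eps / 2)) as [N1 A1]; [lra|]. destruct (Hb (eps / 2)) as [N2 A2]; [lra|].
  exists (N1 + N2)%nat. intros n Hn. rewrite csum_plus.
  replace (csum a n + csum b n - (s + t))%C with ((csum a n - s) + (csum b n - t))%C by ring.
  eapply Rle_trans; [apply Cmod_triangle|].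
  assert (Cmod (csum a n - s) <= eps / 2) by (apply A1; lia).
  assert (Cmod (csum b n - t) <= eps / 2) by (apply A2; lia). lra.
Qed.

Lemma csumto_scal c a s : csumto a s -> csumto (fun n => c * a n)%C (c * s)%C.
Proof.
  intros Ha eps Heps. assert (Pc := Cmod_ge_0 c).
  destruct (Ha (eps / (1 + Cmod c))) as [N A1]; [apply Rdiv_lt_0_compat; lra|].
  exists N. intros n Hn. rewrite csum_scal. specialize (A1 n Hn).
  replace (c * csum a n - c * s)%C with (c * (csum a n - s))%C by ring. rewrite Cmod_mult.
  apply Rle_trans with ((1 + Cmod c) * (eps / (1 + Cmod c))).
  - apply Rmult_le_compat; try lra. apply Cmod_ge_0.
  - apply Req_le. field. lra.
Qed.

Lemma csumto_ext a b s : (forall n, a n = b n) -> csumto a s -> csumto b s.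
Proof.
  intros E H eps Heps. destruct (H eps Heps) as [N HN]. exists N. intros n Hn.
  rewrite <- (csum_ext a b n); auto.
Qed.

Lemma csumto_S_l a s : csumto a s -> csumto (fun n => a (S n)) (s - a 0%nat)%C.
Proof.
  intros H eps Heps. destruct (H eps Heps) as [N HN]. exists N. intros n Hn.
  specialize (HN (S n)). rewrite csum_S_l in HN.
  replace (csum (fun n => a (S n)) n - (s - a 0%nat))%C with (a 0%nat + csum (fun n => a (S n)) n - s)%C by ring.
  apply HN. lia.
Qed.

Lemma csumto_bound a s K q : 0 <= q < 1 -> csumto a s -> (forall n, Cmod (a n) <= K * q ^ n) -> Cmod s <= K / (1 - q).
Proof.
  intros Hq H Ha. replace s with (s - 0)%C by ring. apply csumto_le with (1 := H).
  intros N. exists N; split; auto. replace (csum a N - 0)%C with (csum a N) by ring.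
  now apply csum_bound.
Qed.

(* The power series with coefficients [a] has radius of convergence at least 1. *)
Definition rad (a : nat -> C) : Prop :=
  forall rho, 0 < rho < 1 -> exists M, forall n, Cmod (a n) * rho ^ n <= M.

Definition pse (a : nat -> C) (z : C) : C := cser (fun n => a n * z ^ n)%C.

Lemma pse_term_bound a z r rho M : 0 < rho -> Cmod z <= r -> (forall n, Cmod (a n) * rho ^ n <= M) ->
  forall n, Cmod (a n * z ^ n) <= M * (r / rho) ^ n.
Proof.
  intros Hrho Hz HM n. rewrite Cmod_mult, Cmod_pow. unfold Rdiv. rewrite Rpow_mult_distr, pow_inv.
  assert (P : 0 < rho ^ n) by now apply pow_lt.
  apply Rle_trans with (Cmod (a n) * r ^ n).
  - apply Rmult_le_compat_l; [apply Cmod_ge_0|]. apply pow_incr. split; [apply Cmod_ge_0|auto].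
  - replace (Cmod (a n) * r ^ n) with (Cmod (a n) * rho ^ n * (r ^ n * / rho ^ n)) by (field; lra).
    apply Rmult_le_compat_r; auto.
    apply Rmult_le_pos; [|left; now apply Rinv_0_lt_compat].
    apply pow_le. eapply Rle_trans; [apply Cmod_ge_0|exact Hz].
Qed.

Lemma pse_unif a r : rad a -> 0 <= r < 1 -> exists K q, 0 <= q < 1 /\
  forall z, Cmod z <= r -> (forall n, Cmod (a n * z ^ n) <= K * q ^ n) /\
    forall N, Cmod (csum (fun n => a n * z ^ n)%C N - pse a z) <= K / (1 - q) * q ^ N.
Proof.
  intros Ha Hr. destruct (Ha ((1 + r) / 2)) as [M HM]; [lra|].
  exists M, (r / ((1 + r) / 2)).
  assert (Hq : 0 <= r / ((1 + r) / 2) < 1).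
  { split; [apply Rdiv_le_0_compat; lra|apply Rlt_div_l; lra]. }
  split; auto. intros z Hz.
  assert (B := pse_term_bound a z r ((1 + r) / 2) M ltac:(lra) Hz HM).
  split; auto. now apply cser_tail.
Qed.

Lemma pse_csumto a z : rad a -> inD z -> csumto (fun n => a n * z ^ n)%C (pse a z).
Proof.
  intros Ha Hz. destruct (pse_unif a (Cmod z) Ha) as (K & q & Hq & H).
  { split; [apply Cmod_ge_0|exact Hz]. }
  apply csumto_geom with (1 := Hq) (K := K / (1 - q)). apply H. lra.
Qed.

Lemma rad_shift a : rad a -> rad (fun n => a (S n)).
Proof.
  intros Ha rho Hr. destruct (Ha rho Hr) as [M HM]. exists (M / rho). intros n.
  specialize (HM (S n)). simpl in HM. apply Rmult_le_reg_r with rho; [lra|].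
  replace (M / rho * rho) with M by (field; lra). lra.
Qed.

(** None of 1, x, ..., x^(n-1) is below x^n, so n x^n is at most their sum (1 - x^n) / (1 - x); the
    induction proves this form. *)
Lemma INR_pow_le x n : 0 <= x < 1 -> INR n * x ^ n <= / (1 - x).
Proof.
  intros Hx.
  assert (H : INR n * x ^ n * (1 - x) <= 1 - x ^ n).
  { induction n; [simpl; lra|]. rewrite S_INR. simpl.
    assert (P : 0 <= x ^ n <= 1).
    { split; [apply pow_le; lra|]. rewrite <- (pow1 n). apply pow_incr; lra. }
    assert (I := Rmult_le_compat_l x _ _ (proj1 Hx) IHn).
    assert (J : 0 <= (1 - x) * (1 - x * x ^ n)) by (apply Rmult_le_pos; nra). lra. }
  assert (P : 0 <= x ^ n) by (apply pow_le; lra).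
  apply Rmult_le_reg_r with (1 - x); [lra|]. rewrite Rinv_l by lra. lra.
Qed.

Lemma rad_INR a : rad a -> rad (fun n => RtoC (INR n) * a n)%C.
Proof.
  intros Ha rho Hr. destruct (Ha ((1 + rho) / 2)) as [M HM]; [lra|].
  set (x := rho / ((1 + rho) / 2)).
  assert (Hx : 0 <= x < 1).
  { unfold x. split; [apply Rdiv_le_0_compat; lra|apply Rlt_div_l; lra]. }
  exists (/ (1 - x) * M). intros n.
  rewrite Cmod_mult, Cmod_R, Rabs_pos_eq by apply pos_INR.
  replace (rho ^ n) with (x ^ n * ((1 + rho) / 2) ^ n).
  - replace (INR n * Cmod (a n) * (x ^ n * ((1 + rho) / 2) ^ n))
      with ((INR n * x ^ n) * (Cmod (a n) * ((1 + rho) / 2) ^ n)) by ring.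
    apply Rmult_le_compat; auto.
    + apply Rmult_le_pos; [apply pos_INR|apply pow_le; lra].
    + apply Rmult_le_pos; [apply Cmod_ge_0|apply pow_le; lra].
    + now apply INR_pow_le.
  - rewrite <- Rpow_mult_distr. f_equal. unfold x. field. lra.
Qed.

(** The remainder satisfies E_(n+1) = w E_n + (n+1) z^n (w - z)^2. The factor r^2 on the left avoids
    the exponent n - 1 and a division by r. The constant (n+1)^2 is crude, but any polynomial growth
    is harmless by [rad_INR]. *)
Lemma pow_taylor2 z w r n : 0 <= r -> Cmod z <= r -> Cmod w <= r ->
  Cmod (w ^ S n - z ^ S n - RtoC (INR (S n)) * z ^ n * (w - z)) * r ^ 2
    <= INR (S n) * (INR (S n) * r ^ S n) * Cmod (w - z) ^ 2.
Proof.
  intros Hr Hz Hw.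
  assert (Pd : 0 <= Cmod (w - z)) by apply Cmod_ge_0.
  induction n.
  - simpl. replace (w * 1 - z * 1 - 1 * 1 * (w - z))%C with (RtoC 0) by ring. rewrite Cmod_0.
    rewrite Rmult_0_l. repeat apply Rmult_le_pos; lra.
  - set (E := (w ^ S n - z ^ S n - RtoC (INR (S n)) * z ^ n * (w - z))%C) in *.
    replace (w ^ S (S n) - z ^ S (S n) - RtoC (INR (S (S n))) * z ^ S n * (w - z))%C
      with (w * E + RtoC (INR (S n)) * z ^ n * ((w - z) * (w - z)))%C
      by (unfold E; rewrite (S_INR (S n)), RtoC_plus; simpl Cpow; ring).
    rewrite (S_INR (S n)). set (m := INR (S n)) in *.
    assert (Hm : 1 <= m) by (unfold m; rewrite S_INR; generalize (pos_INR n); lra).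
    assert (Pr : 0 <= r ^ n) by now apply pow_le.
    assert (B : Cmod (w * E + RtoC m * z ^ n * ((w - z) * (w - z))) <= r * Cmod E + m * r ^ n * Cmod (w - z) ^ 2).
    { eapply Rle_trans; [apply Cmod_triangle|]. rewrite !Cmod_mult, Cmod_pow, Cmod_R, Rabs_pos_eq by lra.
      apply Rplus_le_compat.
      - apply Rmult_le_compat_r; [apply Cmod_ge_0|auto].
      - replace (Cmod (w - z) ^ 2) with (Cmod (w - z) * Cmod (w - z)) by ring.
        apply Rmult_le_compat_r; [nra|]. apply Rmult_le_compat_l; [lra|].
        apply pow_incr. split; [apply Cmod_ge_0|auto]. }
    set (D := Cmod (w - z) ^ 2) in *.
    assert (PD : 0 <= D) by (unfold D; nra).
    assert (Pr2 : 0 <= r ^ 2) by nra.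
    apply Rle_trans with ((r * Cmod E + m * r ^ n * D) * r ^ 2).
    { now apply Rmult_le_compat_r. }
    replace ((r * Cmod E + m * r ^ n * D) * r ^ 2) with (r * (Cmod E * r ^ 2) + m * (r ^ S (S n) * D)) by (simpl; ring).
    assert (I2 := Rmult_le_compat_l r _ _ Hr IHn).
    assert (PT : 0 <= r ^ S (S n) * D) by (apply Rmult_le_pos; [now apply pow_le|auto]).
    replace (r * (m * (m * r ^ S n) * D)) with (m * m * (r ^ S (S n) * D)) in I2 by (simpl; ring).
    replace ((m + 1) * ((m + 1) * r ^ S (S n)) * D) with ((m + 1) * (m + 1) * (r ^ S (S n) * D)) by ring.
    nra.
Qed.

Lemma cdiff_pse a z : rad a -> inD z ->
  cdiff (pse a) z (pse (fun n => RtoC (INR (S n)) * a (S n)) z)%C.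
Proof.
  intros Ha Hz. assert (P0 := Cmod_ge_0 z). unfold inD in Hz.
  assert (Hb := rad_shift _ (rad_INR a Ha)). cbv beta in Hb.
  set (b := fun n => (RtoC (INR (S n)) * a (S n))%C) in *.
  set (r := (1 + Cmod z) / 2).
  assert (Hr : 0 < r < 1) by (unfold r; lra).
  set (s := (1 + r) / 2).
  (* Used twice because of the square of the degree in [pow_taylor2]. The points [w] range over |w|
     <= r, and s > r turns the bound into a geometric one of ratio q = r / s. *)
  destruct (rad_INR _ (rad_INR a Ha) s) as [M HM]; [unfold s; lra|].
  set (q := r / s).
  assert (Hq : 0 <= q < 1).
  { unfold q, s. split; [apply Rdiv_le_0_compat; lra|apply Rlt_div_l; lra]. }
  set (L := M / (1 - q) / r ^ 2).
  assert (HM0 : 0 <= M).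
  { eapply Rle_trans; [|apply (HM 0%nat)]. apply Rmult_le_pos; [apply Cmod_ge_0|simpl; lra]. }
  assert (Pr2 : 0 < r ^ 2) by (apply pow_lt; lra).
  assert (HL : 0 <= L).
  { unfold L. apply Rdiv_le_0_compat; [|auto]. apply Rdiv_le_0_compat; lra. }
  assert (Main : forall w, Cmod w <= r -> Cmod (pse a w - pse a z - pse b z * (w - z)) <= L * Cmod (w - z) ^ 2).
  { intros w Hw.
    set (e := fun n => match n with O => RtoC 0 | S n => (a (S n) * (w ^ S n - z ^ S n - RtoC (INR (S n)) * z ^ n * (w - z)))%C end).
    assert (Se : csumto (fun n => e (S n)) (pse a w - pse a z - pse b z * (w - z))%C).
    { assert (S1 := csumto_S_l _ _ (pse_csumto a w Ha ltac:(unfold inD; lra))).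
      assert (S2 := csumto_scal (- (1))%C _ _ (csumto_S_l _ _ (pse_csumto a z Ha Hz))).
      assert (S3 := csumto_scal (- (w - z))%C _ _ (pse_csumto b z Hb Hz)).
      assert (S4 := csumto_plus _ _ _ _ (csumto_plus _ _ _ _ S1 S2) S3).
      replace (pse a w - pse a z - pse b z * (w - z))%C with
        (pse a w - a 0%nat * w ^ 0 + - (1) * (pse a z - a 0%nat * z ^ 0) + - (w - z) * pse b z)%C by (simpl; ring).
      eapply csumto_ext; [|exact S4]. intros n. unfold e, b. ring. }
    apply Rle_trans with (M * q * Cmod (w - z) ^ 2 / r ^ 2 / (1 - q)).
    - apply csumto_bound with (1 := Hq) (2 := Se). intros n. unfold e. rewrite Cmod_mult.
      assert (T := pow_taylor2 z w r n ltac:(lra) ltac:(unfold r; lra) Hw).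
      set (E := Cmod (w ^ S n - z ^ S n - RtoC (INR (S n)) * z ^ n * (w - z))) in *.
      assert (PE : 0 <= Cmod (w - z) ^ 2) by (apply pow_le, Cmod_ge_0).
      specialize (HM (S n)). rewrite !Cmod_mult, !Cmod_R, Rabs_pos_eq in HM by apply pos_INR.
      apply Rmult_le_reg_r with (r ^ 2); auto.
      replace (M * q * Cmod (w - z) ^ 2 / r ^ 2 * q ^ n * r ^ 2) with (M * q ^ S n * Cmod (w - z) ^ 2) by (simpl; field; lra).
      rewrite Rmult_assoc.
      eapply Rle_trans; [apply Rmult_le_compat_l; [apply Cmod_ge_0|exact T]|].
      replace (Cmod (a (S n)) * (INR (S n) * (INR (S n) * r ^ S n) * Cmod (w - z) ^ 2))
        with (INR (S n) * (INR (S n) * Cmod (a (S n))) * r ^ S n * Cmod (w - z) ^ 2) by ring.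
      apply Rmult_le_compat_r; auto.
      replace (r ^ S n) with (s ^ S n * q ^ S n).
      + rewrite <- Rmult_assoc. apply Rmult_le_compat_r; [apply pow_le; lra|]. exact HM.
      + rewrite <- Rpow_mult_distr. f_equal. unfold q, s. field. lra.
    - assert (0 <= L * Cmod (w - z) ^ 2 * (1 - q)).
      { apply Rmult_le_pos; [apply Rmult_le_pos; [exact HL|apply pow_le, Cmod_ge_0]|lra]. }
      replace (M * q * Cmod (w - z) ^ 2 / r ^ 2 / (1 - q)) with (L * Cmod (w - z) ^ 2 * q) by (unfold L; field; lra).
      lra. }
  intros eps Heps.
  exists (Rmin (r - Cmod z) (eps / (L + 1))). split.
  { apply Rmin_pos; [unfold r; lra|apply Rdiv_lt_0_compat; lra]. }
  intros w Hw.
  assert (H1 := Rlt_le_trans _ _ _ Hw (Rmin_l _ _)). assert (H2 := Rlt_le_trans _ _ _ Hw (Rmin_r _ _)).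
  eapply Rle_trans; [apply Main|].
  - generalize (Cmod_triangle (w - z) z). replace (w - z + z)%C with w by ring. lra.
  - simpl. assert (Pd := Cmod_ge_0 (w - z)). rewrite Rmult_1_r, <- Rmult_assoc.
    apply Rmult_le_compat_r; auto.
    apply Rle_trans with ((L + 1) * (eps / (L + 1))).
    + apply Rmult_le_compat; lra.
    + apply Req_le. field. lra.
Qed.

Lemma Hol_pse a : rad a -> Hol (pse a).
Proof. intros Ha. apply Hol_cdiff. intros z Hz. eexists. now apply cdiff_pse. Qed.

(** * Holomorphic functions on the disc *)

Lemma cauchy_coef_rad f : Hol f -> rad (cauchy_coef f).
Proof.
  intros Hf rho Hr. assert (HPI := PI_RGT_0).
  destruct (rcont_bounded (fun t => f (pol rho t)) 0 (2 * PI)) as [M HM]; [lra| |].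
  - intros t _. apply (rcont_comp f (fun t => pol rho t)); [|apply rcont_pol].
    destruct (proj1 (Hol_cdiff f) Hf (pol rho t)) as [l Hl]; [unfold inD; rewrite Cmod_pol; lra|].
    eapply cdiff_ccont; eauto.
  - exists M. intros n. now apply cauchy_estimate.
Qed.

Lemma Hol_csumto f z : Hol f -> inD z -> csumto (fun n => cauchy_coef f n * z ^ n)%C (f z).
Proof.
  intros Hf Hz. assert (P0 := Cmod_ge_0 z). unfold inD in Hz.
  destruct (cauchy_expansion f z ((1 + Cmod z) / 2) Hf Hz) as [K HK]; [lra|].
  apply csumto_geom with (2 := HK).
  split; [apply Rdiv_le_0_compat; lra|apply Rlt_div_l; lra].
Qed.

Lemma Hol_eq_pse f z : Hol f -> inD z -> f z = pse (cauchy_coef f) z.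
Proof. intros Hf Hz. symmetry. apply csumto_cser. now apply Hol_csumto. Qed.

Lemma Hol_poly_approx f r eps : Hol f -> 0 <= r < 1 -> 0 < eps ->
  exists a N, forall z, Cmod z <= r -> Cmod (csum (fun n => a n * z ^ n)%C N - f z) <= eps.
Proof.
  intros Hf Hr Heps.
  destruct (pse_unif (cauchy_coef f) r (cauchy_coef_rad f Hf) Hr) as (K & q & Hq & H).
  destruct (geom_small (K / (1 - q)) q eps Hq Heps) as [N HN].
  exists (cauchy_coef f), N. intros z Hz.
  rewrite (Hol_eq_pse f z Hf) by (unfold inD; lra).
  eapply Rle_trans; [apply H; auto|auto].
Qed.

Lemma Hol_bounded f r : Hol f -> r < 1 -> exists M, 0 <= M /\ forall z, Cmod z <= r -> Cmod (f z) <= M.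
Proof.
  intros Hf Hr.
  destruct (Rle_dec 0 r) as [H0|H0].
  - destruct (pse_unif (cauchy_coef f) r (cauchy_coef_rad f Hf)) as (K & q & Hq & H); [lra|].
    assert (B : forall z, Cmod z <= r -> Cmod (f z) <= K / (1 - q)).
    { intros z Hz. assert (Hz' : inD z) by (unfold inD; lra).
      apply csumto_bound with (1 := Hq) (2 := Hol_csumto f z Hf Hz'). now apply H. }
    exists (K / (1 - q)). split; auto.
    eapply Rle_trans; [apply Cmod_ge_0|apply (B (RtoC 0))]. now rewrite Cmod_0.
  - exists 0. split; [lra|]. intros z Hz. generalize (Cmod_ge_0 z). lra.
Qed.

Lemma Hol_derivative f : Hol f -> exists f', Hol f' /\ forall z, inD z -> cdiff f z (f' z).
Proof.
  intros Hf. assert (Ha := cauchy_coef_rad f Hf).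
  exists (pse (fun n => RtoC (INR (S n)) * cauchy_coef f (S n))%C). split.
  - apply Hol_pse. exact (rad_shift _ (rad_INR _ Ha)).
  - intros z Hz. destruct (inD_nbhd z Hz) as [d [Hd Hw]].
    apply cdiff_ext_loc with (f := pse (cauchy_coef f)) (d := d); auto.
    + intros w Hwd. symmetry. apply Hol_eq_pse; auto.
    + now apply cdiff_pse.
Qed.

Lemma Hol_div_id f : Hol f -> f (RtoC 0) = RtoC 0 ->
  exists g, Hol g /\ forall z, inD z -> f z = (z * g z)%C.
Proof.
  intros Hf H0. assert (Ha := cauchy_coef_rad f Hf). assert (Hb := rad_shift _ Ha).
  exists (pse (fun n => cauchy_coef f (S n))). split; [now apply Hol_pse|].
  assert (I0 : inD (RtoC 0)) by (unfold inD; rewrite Cmod_0; lra).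
  assert (Z : forall g z, Hol g -> inD z -> g z = (cauchy_coef g 0 + z * pse (fun n => cauchy_coef g (S n)) z)%C).
  { intros g z Hg Hz. assert (S1 := csumto_S_l _ _ (Hol_csumto g z Hg Hz)).
    assert (S2 := csumto_scal z _ _ (pse_csumto _ z (rad_shift _ (cauchy_coef_rad g Hg)) Hz)).
    assert (E : (g z - cauchy_coef g 0 * z ^ 0)%C = (z * pse (fun n => cauchy_coef g (S n)) z)%C).
    { apply csumto_unique with (2 := S2). eapply csumto_ext; [|exact S1]. intros n. simpl. ring. }
    rewrite <- E. simpl. ring. }
  intros z Hz. rewrite (Z f z Hf Hz). rewrite (Z f _ Hf I0) in H0.
  replace (cauchy_coef f 0) with (cauchy_coef f 0 + 0 * pse (fun n => cauchy_coef f (S n)) 0)%C by ring.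
  rewrite H0. ring.
Qed.

(** The sum is built from its Taylor coefficients, those of the F k summed over k, so it is a power
    series by construction and no differentiation under the limit occurs. *)
Lemma Hol_series (F : nat -> C -> C) : (forall k, Hol (F k)) ->
  (forall r, 0 < r < 1 -> exists K q, 0 <= q < 1 /\ forall k z, Cmod z <= r -> Cmod (F k z) <= K * q ^ k) ->
  exists f, Hol f /\ forall z, inD z -> csumto (fun k => F k z) (f z).
Proof.
  intros HF HB.
  set (A := fun k n => cauchy_coef (F k) n).
  set (b := fun n => cser (fun k => A k n)).
  (* Cauchy's estimates make the tails in k small uniformly in the degree n, once weighted by r^n.
     Taking r > |z| later leaves a convergent geometric series in n. *)
  assert (HA : forall r, 0 < r < 1 -> exists K q, 0 <= K /\ 0 <= q < 1 /\ forall n,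
     (forall N, Cmod (csum (fun k => A k n) N - b n) * r ^ n <= K * q ^ N)).
  { intros r Hr. destruct (HB r Hr) as (K & q & Hq & H). exists (K / (1 - q)), q.
    assert (HK : 0 <= K).
    { eapply Rle_trans; [apply (Cmod_ge_0 (F 0%nat 0))|].
      replace K with (K * q ^ 0) by (simpl; ring). apply H. rewrite Cmod_0; lra. }
    split; [apply Rdiv_le_0_compat; lra|]. split; auto.
    intros n N. assert (Pr : 0 < r ^ n) by (apply pow_lt; lra).
    assert (T : forall k, Cmod (A k n) <= K / r ^ n * q ^ k).
    { intros k. apply Rmult_le_reg_r with (r ^ n); auto.
      replace (K / r ^ n * q ^ k * r ^ n) with (K * q ^ k) by (field; lra).
      apply cauchy_estimate; auto. intros t _. apply H. rewrite Cmod_pol; lra. }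
    destruct (cser_tail _ _ _ Hq T) as [_ T2]. specialize (T2 N). fold (b n) in T2.
    apply Rmult_le_compat_r with (r := r ^ n) in T2; [|lra].
    replace (K / r ^ n / (1 - q) * q ^ N * r ^ n) with (K / (1 - q) * q ^ N) in T2 by (field; lra). exact T2. }
  assert (Rb : rad b).
  { intros rho Hr. destruct (HA rho Hr) as (K & q & HK & Hq & H). exists K. intros n.
    specialize (H n 0%nat). simpl in H. replace (0 - b n)%C with (- b n)%C in H by ring.
    rewrite Cmod_opp in H. lra. }
  exists (pse b). split; [now apply Hol_pse|].
  intros z Hz. assert (P0 := Cmod_ge_0 z). unfold inD in Hz.
  set (r := (1 + Cmod z) / 2).
  assert (Hr : 0 < r < 1) by (unfold r; lra).
  destruct (HA r Hr) as (K & q & HK & Hq & H).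
  set (x := Cmod z / r).
  assert (Hx : 0 <= x < 1).
  { unfold x. split; [apply Rdiv_le_0_compat; lra|apply Rlt_div_l; unfold r; lra]. }
  apply csumto_geom with (1 := Hq) (K := K / (1 - x)). intros N.
  assert (S1 : csumto (fun n => csum (fun k => A k n) N * z ^ n)%C (csum (fun k => F k z) N)).
  { clear H. induction N; simpl.
    - intros e He. exists 0%nat. intros n _.
      replace (csum (fun n => 0 * z ^ n)%C n) with (RtoC 0).
      + replace (0 - 0)%C with (RtoC 0) by ring. rewrite Cmod_0; lra.
      + rewrite csum_scal. ring.
    - eapply csumto_ext; [|exact (csumto_plus _ _ _ _ IHN (Hol_csumto (F N) z (HF N) Hz))].
      intros n. unfold A. simpl. ring. }
  assert (S2 := csumto_plus _ _ _ _ S1 (csumto_scal (- (1))%C _ _ (pse_csumto b z Rb Hz))).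
  replace (csum (fun k => F k z) N - pse b z)%C with (csum (fun k => F k z) N + - (1) * pse b z)%C by ring.
  replace (K / (1 - x) * q ^ N) with (K * q ^ N / (1 - x)) by (field; lra).
  apply csumto_bound with (1 := Hx) (2 := S2). intros n.
  replace (csum (fun k => A k n) N * z ^ n + - (1) * (b n * z ^ n))%C
    with ((csum (fun k => A k n) N - b n) * z ^ n)%C by ring.
  rewrite Cmod_mult, Cmod_pow. specialize (H n N).
  replace (Cmod z ^ n) with (r ^ n * x ^ n)
    by (rewrite <- Rpow_mult_distr; f_equal; unfold x; field; lra).
  rewrite <- Rmult_assoc. apply Rmult_le_compat_r; [apply pow_le; lra|exact H].
Qed.

(** * Growth of the cocycle over the rotation *)

Lemma Cmod_pow_unit g n : Cmod g = 1 -> Cmod (g ^ n) = 1.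
Proof. intros H. now rewrite Cmod_pow, H, pow1. Qed.

Lemma geom_csum w N : ((w - 1) * csum (fun k => w ^ k) N = w ^ N - 1)%C.
Proof. induction N; simpl; [ring|]. rewrite Cmult_plus_distr_l, IHN. ring. Qed.

(** The sum is z^j times a geometric series of ratio g^j, hence at most 2 / |g^j - 1|: the small
    divisor appears here. *)
Lemma birkhoff_monomial g j : Cmod g = 1 -> (g ^ j)%C <> RtoC 1 ->
  exists B, forall z, Cmod z <= 1 -> forall N, Cmod (csum (fun k => (g ^ k * z) ^ j)%C N) <= B.
Proof.
  intros Hg Hj.
  assert (Hn : (g ^ j - 1)%C <> RtoC 0).
  { intros E. apply Hj. replace (g ^ j)%C with (g ^ j - 1 + 1)%C by ring. rewrite E. ring. }
  assert (P : 0 < Cmod (g ^ j - 1)) by now apply Cmod_gt_0.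
  exists (2 / Cmod (g ^ j - 1)). intros z Hz N.
  rewrite (csum_ext _ (fun k => z ^ j * (g ^ j) ^ k)%C).
  2:{ intros k _. rewrite Cpow_mult_l, <- !Cpow_mult_r, (Nat.mul_comm k j). ring. }
  rewrite (csum_scal (z ^ j)%C (fun k => (g ^ j) ^ k)%C), Cmod_mult.
  assert (Pz : Cmod (z ^ j) <= 1).
  { rewrite Cmod_pow, <- (pow1 j). apply pow_incr. split; [apply Cmod_ge_0|auto]. }
  apply Rmult_le_reg_l with (1 := P).
  replace (Cmod (g ^ j - 1) * (2 / Cmod (g ^ j - 1))) with (1 * 2) by (field; lra).
  replace (Cmod (g ^ j - 1) * (Cmod (z ^ j) * Cmod (csum (fun k => (g ^ j) ^ k)%C N)))
    with (Cmod (z ^ j) * Cmod ((g ^ j - 1) * csum (fun k => (g ^ j) ^ k)%C N)) by (rewrite Cmod_mult; ring).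
  rewrite geom_csum. apply Rmult_le_compat; auto; try apply Cmod_ge_0.
  eapply Rle_trans; [apply Cmod_minus_le|].
  rewrite Cmod_1, Cmod_pow_unit by (now apply Cmod_pow_unit). lra.
Qed.

(** The exponent [S j] excludes degree 0, whose Birkhoff sums grow linearly. [B] depends on [J]
    through finitely many divisors, and no uniformity in [J] is asserted. *)
Lemma birkhoff_poly g c J : Cmod g = 1 -> (forall n, (1 <= n)%nat -> (g ^ n)%C <> RtoC 1) ->
  exists B, forall z, Cmod z <= 1 -> forall N,
    Cmod (csum (fun k => csum (fun j => c j * (g ^ k * z) ^ S j)%C J) N) <= B.
Proof.
  intros Hg Hr. induction J as [|J [B IH]].
  - exists 0. intros z _ N. simpl.
    replace (csum (fun _ => RtoC 0) N) with (RtoC 0); [rewrite Cmod_0; lra|].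
    induction N; simpl; [|rewrite <- IHN]; ring.
  - destruct (birkhoff_monomial g (S J) Hg) as [B' HB']; [apply Hr; lia|].
    exists (B + Cmod (c J) * B'). intros z Hz N. cbn [csum].
    rewrite csum_plus, csum_scal. eapply Rle_trans; [apply Cmod_triangle|].
    rewrite Cmod_mult. apply Rplus_le_compat; [now apply IH|].
    apply Rmult_le_compat_l; [apply Cmod_ge_0|now apply HB'].
Qed.

Lemma rdiff_is_derive_lin (p : C -> R) f t l :
  (forall z, Rabs (p z) <= Cmod z) -> (forall z w, p (z - w)%C = p z - p w) ->
  (forall x z, p (RtoC x * z)%C = x * p z) ->
  rdiff f t l -> is_derive (fun s => p (f s)) t (p l).
Proof.
  intros Hp Hm Hs H. apply is_derive_Reals. intros eps Heps.
  destruct (H (eps / 2)) as [d [Hd Hw]]; [lra|].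
  exists (mkposreal d Hd). intros h Hh Hhd. simpl in Hhd.
  specialize (Hw (t + h)). replace (t + h - t) with h in Hw by ring. specialize (Hw Hhd).
  assert (Ph : 0 < Rabs h) by now apply Rabs_pos_lt.
  replace ((p (f (t + h)) - p (f t)) / h - p l) with (p (f (t + h)%R - f t - RtoC h * l)%C / h).
  - unfold Rdiv. rewrite Rabs_mult, Rabs_inv.
    apply Rmult_lt_reg_r with (Rabs h); auto. rewrite Rmult_assoc, Rinv_l by lra. rewrite Rmult_1_r.
    eapply Rle_lt_trans; [apply Hp|]. nra.
  - rewrite !Hm, Hs. field. auto.
Qed.

Lemma rdiff_fst f t l : rdiff f t l -> is_derive (fun s => fst (f s)) t (fst l).
Proof.
  apply rdiff_is_derive_lin; try (intros; simpl; ring).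
  intros z. eapply Rle_trans; [apply Rmax_l|apply Rmax_Cmod].
Qed.

Lemma rdiff_snd f t l : rdiff f t l -> is_derive (fun s => snd (f s)) t (snd l).
Proof.
  apply rdiff_is_derive_lin; try (intros; simpl; ring).
  intros z. eapply Rle_trans; [apply Rmax_r|apply Rmax_Cmod].
Qed.

Lemma ln_Cmod z : z <> RtoC 0 -> ln (Cmod z) = / 2 * ln (fst z * fst z + snd z * snd z).
Proof.
  intros H. assert (P : 0 < Cmod z) by now apply Cmod_gt_0.
  replace (fst z * fst z + snd z * snd z) with (Cmod z * Cmod z).
  - rewrite ln_mult by auto. lra.
  - replace (Cmod z * Cmod z) with (Cmod z ^ 2) by ring. rewrite Cmod2_alt. unfold Re, Im. ring.
Qed.

Lemma cdiff_csum (f f' : nat -> C -> C) J z : (forall j, cdiff (f j) z (f' j z)) ->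
  cdiff (fun w => csum (fun j => f j w) J) z (csum (fun j => f' j z) J).
Proof.
  intros H. induction J; simpl; [apply cdiff_const|]. now apply cdiff_plus.
Qed.

(** The real part of the logarithmic derivative, obtained without a complex logarithm; writing ln|g|
    as half of ln(u^2 + v^2) also avoids differentiating a square root. *)
Lemma ln_Cmod_derive g t l : rdiff g t l -> g t <> RtoC 0 ->
  is_derive (fun s => / 2 * ln (fst (g s) * fst (g s) + snd (g s) * snd (g s))) t (fst (l * / g t)%C).
Proof.
  intros Hg Hn.
  assert (D1 := rdiff_fst _ _ _ Hg). assert (D2 := rdiff_snd _ _ _ Hg).
  set (u := fun s => fst (g s)) in *. set (v := fun s => snd (g s)) in *.
  assert (P : 0 < u t * u t + v t * v t).
  { assert (P : 0 < Cmod (g t)) by now apply Cmod_gt_0.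
    assert (E : Cmod (g t) ^ 2 = u t ^ 2 + v t ^ 2) by (rewrite Cmod2_alt; reflexivity). nra. }
  assert (D : is_derive (fun s => u s * u s + v s * v s) t ((fst l * u t + u t * fst l) + (snd l * v t + v t * snd l))).
  { apply (is_derive_plus (K := R_AbsRing) (V := R_NormedModule)).
    - now apply Derive.is_derive_mult.
    - now apply Derive.is_derive_mult. }
  assert (D' := is_derive_comp (K := R_AbsRing) (V := R_NormedModule) ln _ _ _ _ (is_derive_ln _ P) D).
  apply (is_derive_scal _ _ (/ 2)) in D'.
  match type of D' with is_derive _ _ ?a => replace (fst (l * / g t)%C) with a; [exact D'|] end.
  unfold scal; simpl; unfold mult; simpl. fold (u t) (v t).
  change (fst (g t)) with (u t). change (snd (g t)) with (v t). field; nra.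
Qed.

Lemma ln_Cmod_approx m r eps : Hol m -> (forall z, inD z -> m z <> RtoC 0) -> 0 <= r < 1 -> 0 < eps ->
  exists c J, forall z, Cmod z <= r ->
    Rabs (ln (Cmod (m z)) - ln (Cmod (m 0)) - fst (csum (fun j => c j * z ^ S j)%C J)) <= eps.
Proof.
  intros Hm N Hr Heps.
  destruct (Hol_derivative m Hm) as [m' [Hm' D]].
  destruct (Hol_poly_approx (fun z => m' z * / m z)%C r eps) as [a [J HJ]]; auto.
  { apply Hol_mult; auto. now apply Hol_inv. }
  exists (fun j => (a j * / RtoC (INR (S j)))%C), J. intros z Hz.
  set (Q := fun w => csum (fun j => a j * / RtoC (INR (S j)) * w ^ S j)%C J).
  set (p := fun w => csum (fun j => a j * w ^ j)%C J).
  assert (DQ : forall w, cdiff Q w (p w)).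
  { intros w. apply (cdiff_csum (fun j w => a j * / RtoC (INR (S j)) * w ^ S j)%C (fun j w => a j * w ^ j)%C).
    intros j. replace (a j * w ^ j)%C with (a j * / RtoC (INR (S j)) * (RtoC (INR (S j)) * w ^ j))%C.
    - apply (cdiff_cmult _ (fun w => w ^ S j)%C), cdiff_pow.
    - field. intros E. apply RtoC_inj in E. generalize (S_INR j) (pos_INR j). lra. }
  set (phi := fun t => / 2 * ln (fst (m (RtoC t * z)%C) * fst (m (RtoC t * z)%C) + snd (m (RtoC t * z)%C) * snd (m (RtoC t * z)%C)) - fst (Q (RtoC t * z)%C)).
  (* Mean value inequality on the ray to [z]: the derivative of [phi] is the real part of (m'/m -
     p)(t z) z, at most eps in modulus since |z| <= 1. At t = 0 only ln|m(0)| remains, because [Q]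
     vanishes at 0. *)
  assert (B : Rabs (phi 1 - phi 0) <= eps * Rabs (1 - 0)).
  { apply bounded_variation with (dh := fun t => fst (m' (RtoC t * z) * z * / m (RtoC t * z))%C - fst (p (RtoC t * z) * z)%C).
    intros t Ht. rewrite !Rminus_0_r, Rabs_R1 in Ht.
    assert (Htz : Cmod (t * z) <= r).
    { rewrite Cmod_mult, Cmod_R. generalize (Cmod_ge_0 z). nra. }
    assert (HtD : inD (t * z)%C) by (unfold inD; lra).
    assert (L : rdiff (fun t => RtoC t * z)%C t z).
    { intros e He. exists 1; split; [lra|]. intros s _.
      replace (s * z - t * z - (s - t)%R * z)%C with (RtoC 0) by (rewrite RtoC_minus; ring).
      rewrite Cmod_0. apply Rmult_le_pos; [lra|apply Rabs_pos]. }
    split.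
    - apply (is_derive_minus (K := R_AbsRing) (V := R_NormedModule)).
      + apply (ln_Cmod_derive (fun t => m (RtoC t * z)%C)); [|auto].
        apply (rdiff_comp m (fun t => RtoC t * z)%C); auto.
      + apply (rdiff_fst (fun t => Q (RtoC t * z)%C)).
        apply (rdiff_comp Q (fun t => RtoC t * z)%C); auto.
    - replace (fst (m' (RtoC t * z) * z * / m (RtoC t * z))%C - fst (p (RtoC t * z) * z)%C)
        with (- fst ((p (RtoC t * z)%C - m' (RtoC t * z)%C * / m (RtoC t * z)%C) * z)%C).
      + rewrite Rabs_Ropp.
        eapply Rle_trans; [eapply Rle_trans; [apply Rmax_l|apply Rmax_Cmod]|].
        rewrite Cmod_mult. specialize (HJ _ Htz). fold (p (t * z)%C) in HJ.
        replace eps with (eps * 1) by ring.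
        apply Rmult_le_compat; auto; try apply Cmod_ge_0. lra.
      + replace (m' (RtoC t * z) * z * / m (RtoC t * z))%C with (m' (RtoC t * z) * / m (RtoC t * z) * z)%C by ring.
        generalize (m' (RtoC t * z) * / m (RtoC t * z))%C (p (RtoC t * z)%C). intros x y. simpl. ring. }
  unfold phi in B.
  rewrite Cmult_1_l, Cmult_0_l, Rminus_0_r, Rabs_R1, Rmult_1_r in B.
  rewrite !ln_Cmod by (apply N; unfold inD; try rewrite Cmod_0; lra).
  replace (Q 0) with (RtoC 0) in B.
  - match goal with |- Rabs ?a <= _ => match type of B with Rabs ?b <= _ => replace a with b; [exact B|] end end.
    fold (Q z). simpl (fst (RtoC 0)). ring.
  - unfold Q. symmetry. clear. induction J; cbn [csum]; auto. rewrite IHJ, Cpow_S. ring.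
Qed.

(** The weight of an iterate: the n-th power of f |-> m (f o g) sends f to the function with value
    [cocycle m g z n * f (g ^ n * z)] at z. *)
Fixpoint cocycle (m : C -> C) (g z : C) (n : nat) : C :=
  match n with O => RtoC 1 | S n => (cocycle m g z n * m (g ^ n * z))%C end.

Lemma cocycle_bound m g r kappa : Hol m -> (forall z, inD z -> m z <> RtoC 0) ->
  Cmod g = 1 -> (forall n, (1 <= n)%nat -> (g ^ n)%C <> RtoC 1) -> 0 <= r < 1 -> 1 < kappa ->
  exists K, 0 < K /\ forall z, Cmod z <= r -> forall n,
    Cmod (cocycle m g z n) <= K * (kappa * Cmod (m 0)) ^ n.
Proof.
  intros Hm N Hg Hroot Hr Hk.
  assert (Hlk : 0 < ln kappa) by (rewrite <- ln_1; apply ln_increasing; lra).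
  (* An error of ln kappa per factor becomes kappa^n in the product; the polynomial part contributes
     at most exp B for all n together. *)
  destruct (ln_Cmod_approx m r (ln kappa) Hm N Hr Hlk) as [c [J HJ]].
  destruct (birkhoff_poly g c J Hg Hroot) as [B HB].
  exists (exp B). split; [apply exp_pos|]. intros z Hz n.
  assert (Horb : forall k, Cmod (g ^ k * z) = Cmod z).
  { intros k. rewrite Cmod_mult, Cmod_pow_unit; auto. ring. }
  assert (Nm : forall k, m (g ^ k * z)%C <> RtoC 0).
  { intros k. apply N. unfold inD. rewrite Horb. lra. }
  assert (P0 : 0 < Cmod (m 0)) by (apply Cmod_gt_0, N; unfold inD; rewrite Cmod_0; lra).
  set (S := fun n => csum (fun k => csum (fun j => c j * (g ^ k * z) ^ Datatypes.S j)%C J) n).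
  assert (Main : 0 < Cmod (cocycle m g z n) /\
     ln (Cmod (cocycle m g z n)) <= INR n * (ln (kappa * Cmod (m 0))) + fst (S n)).
  { induction n as [|n [IH1 IH2]].
    - simpl. rewrite Cmod_1, ln_1. split; lra.
    - simpl cocycle. assert (Pn : 0 < Cmod (m (g ^ n * z)%C)) by now apply Cmod_gt_0.
      rewrite Cmod_mult. split; [now apply Rmult_lt_0_compat|].
      rewrite ln_mult by auto. rewrite S_INR.
      assert (H1 := HJ (g ^ n * z)%C). rewrite Horb in H1. specialize (H1 Hz).
      apply Rabs_le_between in H1. rewrite (ln_mult kappa) in * by lra.
      change (fst (S (Datatypes.S n))) with (fst (S n) + fst (csum (fun j => c j * (g ^ n * z) ^ Datatypes.S j)%C J)).
      lra. }
  destruct Main as [M1 M2].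
  assert (HS : fst (S n) <= B).
  { eapply Rle_trans; [apply Rle_abs|].
    eapply Rle_trans; [eapply Rle_trans; [apply Rmax_l|apply Rmax_Cmod]|]. apply HB. lra. }
  rewrite <- (exp_ln (Cmod (cocycle m g z n))) by auto.
  rewrite <- Rpower_pow by nra. unfold Rpower. rewrite <- exp_plus.
  destruct (Rle_lt_or_eq_dec (ln (Cmod (cocycle m g z n))) (B + INR n * ln (kappa * Cmod (m 0)))) as [L|L]; [lra| |].
  - left. now apply exp_increasing.
  - rewrite L. lra.
Qed.

(** * The resolvent off the critical circle *)

Lemma cocycle_S_l m g z n : cocycle m g z (S n) = (m z * cocycle m g (g * z) n)%C.
Proof.
  induction n.
  - simpl. rewrite !Cmult_1_l. ring.
  - change (cocycle m g z (S (S n))) with (cocycle m g z (S n) * m (g ^ S n * z))%C.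
    rewrite IHn. simpl. replace (g ^ n * (g * z))%C with (g * g ^ n * z)%C by ring. ring.
Qed.

Lemma Hol_cocycle m g n : Cmod g = 1 -> Hol m -> Hol (fun z => cocycle m g z n).
Proof.
  intros Hg Hm. induction n; simpl; [apply Hol_const|].
  apply (Hol_mult _ (fun z => m (g ^ n * z)%C)); auto.
  apply Hol_rot; auto. now apply Cmod_pow_unit.
Qed.

Lemma twisted_unroll (c : C) (m f G : C -> C) (g : C) (r : R) : Cmod g = 1 ->
  (forall z, Cmod z <= r -> f z = G z + c * m z * f (g * z))%C ->
  forall z, Cmod z <= r -> forall N,
    (f z = csum (fun k => c ^ k * cocycle m g z k * G (g ^ k * z)) N
           + c ^ N * cocycle m g z N * f (g ^ N * z))%C.
Proof.
  intros Hg H z Hz N. induction N.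
  - simpl. rewrite !Cmult_1_l. ring.
  - rewrite IHN at 1. rewrite (H (g ^ N * z)%C).
    + cbn [csum cocycle]. rewrite !Cpow_S.
      replace (g * g ^ N * z)%C with (g * (g ^ N * z))%C by ring. ring.
    + rewrite Cmod_mult, Cmod_pow_unit; lra.
Qed.

(** [K] and [x] are chosen before [c] and depend on it only through [q]. This yields bounds on the
    resolvent that are uniform for parameters near lam. *)
Lemma cocycle_term_bound m g q r : Hol m -> (forall z, inD z -> m z <> RtoC 0) ->
  Cmod g = 1 -> (forall n, (1 <= n)%nat -> (g ^ n)%C <> RtoC 1) -> 0 <= q < 1 -> 0 <= r < 1 ->
  exists K x, 0 < K /\ 0 <= x < 1 /\ forall c, Cmod c * Cmod (m 0) <= q ->
    forall z, Cmod z <= r -> forall n, Cmod (c ^ n * cocycle m g z n) <= K * x ^ n.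
Proof.
  intros Hm N Hg Hroot Hq Hr.
  (* Chosen so that kappa > 1 and still kappa * q = 2 q / (1 + q) < 1. *)
  set (kappa := 2 / (1 + q)).
  assert (Hk : 1 < kappa) by (unfold kappa; apply Rlt_div_r; lra).
  destruct (cocycle_bound m g r kappa Hm N Hg Hroot Hr Hk) as [K [HK HB]].
  exists K, (kappa * q). split; auto. split.
  - split; [apply Rmult_le_pos; lra|].
    replace (kappa * q) with ((2 * q) / (1 + q)) by (unfold kappa; field; lra).
    apply Rlt_div_l; lra.
  - intros c Hc z Hz n. rewrite Cmod_mult, Cmod_pow.
    apply Rle_trans with (Cmod c ^ n * (K * (kappa * Cmod (m 0)) ^ n)).
    + apply Rmult_le_compat_l; [apply pow_le, Cmod_ge_0|auto].
    + replace (Cmod c ^ n * (K * (kappa * Cmod (m 0)) ^ n)) with (K * (kappa * (Cmod c * Cmod (m 0))) ^ n)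
        by (rewrite !Rpow_mult_distr; ring).
      apply Rmult_le_compat_l; [lra|]. apply pow_incr. split.
      * apply Rmult_le_pos; [lra|]. apply Rmult_le_pos; apply Cmod_ge_0.
      * apply Rmult_le_compat_l; lra.
Qed.

(** The size of [f] enters only the remainder of the unrolled equation, which tends to 0; hence [K]
    is independent of [f]. With G = 0 this is injectivity, in general it is the bound on the
    resolvent. *)
Lemma twisted_bound m g q r : Hol m -> (forall z, inD z -> m z <> RtoC 0) ->
  Cmod g = 1 -> (forall n, (1 <= n)%nat -> (g ^ n)%C <> RtoC 1) -> 0 <= q < 1 -> 0 <= r < 1 ->
  exists K, forall c, Cmod c * Cmod (m 0) <= q -> forall f G B, Hol f ->
    (forall z, Cmod z <= r -> f z = G z + c * m z * f (g * z))%C ->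
    (forall z, Cmod z <= r -> Cmod (G z) <= B) ->
    forall z, Cmod z <= r -> Cmod (f z) <= K * B.
Proof.
  intros Hm N Hg Hroot Hq Hr.
  destruct (cocycle_term_bound m g q r Hm N Hg Hroot Hq Hr) as (K & x & HK & Hx & HT).
  exists (K / (1 - x)). intros c Hc f G B Hf E HB z Hz.
  assert (HB0 : 0 <= B) by (eapply Rle_trans; [apply Cmod_ge_0|apply (HB z Hz)]).
  destruct (Hol_bounded f r Hf) as [M [HM0 HM]]; [lra|].
  apply Rle_plus_epsilon. intros eps Heps.
  destruct (geom_small (K * M) x eps Hx Heps) as [n Hn]. specialize (Hn n (Nat.le_refl n)).
  assert (Horb : forall k, Cmod (g ^ k * z) <= r).
  { intros k. rewrite Cmod_mult, Cmod_pow_unit; lra. }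
  rewrite (twisted_unroll c m f G g r Hg E z Hz n).
  eapply Rle_trans; [apply Cmod_triangle|]. apply Rplus_le_compat.
  - replace (K / (1 - x) * B) with (K * B / (1 - x)) by (field; lra).
    apply csum_bound; auto. intros k. rewrite Cmod_mult.
    replace (K * B * x ^ k) with (K * x ^ k * B) by ring.
    apply Rmult_le_compat; try apply Cmod_ge_0; auto.
  - rewrite Cmod_mult. eapply Rle_trans; [|exact Hn].
    replace (K * M * x ^ n) with (K * x ^ n * M) by ring.
    apply Rmult_le_compat; try apply Cmod_ge_0; auto.
Qed.

Lemma twisted_solve m g q c G : Hol m -> (forall z, inD z -> m z <> RtoC 0) ->
  Cmod g = 1 -> (forall n, (1 <= n)%nat -> (g ^ n)%C <> RtoC 1) -> 0 <= q < 1 ->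
  Cmod c * Cmod (m 0) <= q -> Hol G ->
  exists f, Hol f /\ forall z, inD z -> (f z = G z + c * m z * f (g * z))%C.
Proof.
  intros Hm N Hg Hroot Hq Hc HG.
  set (F := fun k z => (c ^ k * cocycle m g z k * G (g ^ k * z))%C).
  destruct (Hol_series F) as [f [Hf Hs]].
  - intros k. apply Hol_mult; [apply Hol_mult; [apply Hol_const|now apply Hol_cocycle]|].
    apply Hol_rot; auto. now apply Cmod_pow_unit.
  - intros r Hr.
    destruct (cocycle_term_bound m g q r Hm N Hg Hroot Hq) as (K & x & HK & Hx & HT); [lra|].
    destruct (Hol_bounded G r HG) as [M [HM0 HM]]; [lra|].
    exists (K * M), x. split; auto. intros k z Hz. unfold F. rewrite Cmod_mult.
    replace (K * M * x ^ k) with (K * x ^ k * M) by ring.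
    apply Rmult_le_compat; try apply Cmod_ge_0; auto.
    apply HM. rewrite Cmod_mult, Cmod_pow_unit; lra.
  - exists f. split; auto. intros z Hz.
    assert (S1 := csumto_S_l _ _ (Hs z Hz)).
    assert (S2 := csumto_scal (c * m z)%C _ _ (Hs (g * z)%C (inD_rot g z Hg Hz))).
    (* By [cocycle_S_l] the series without its first term is c m(z) times the series at g z. *)
    assert (E : (f z - F 0%nat z)%C = (c * m z * f (g * z))%C).
    { apply csumto_unique with (2 := S2). eapply csumto_ext; [|exact S1].
      intros k. unfold F. rewrite cocycle_S_l, !Cpow_S.
      replace (g * g ^ k * z)%C with (g ^ k * (g * z))%C by ring. ring. }
    rewrite <- E. unfold F. simpl. rewrite !Cmult_1_l. ring.
Qed.

(* The last hypothesis turns the resolvent equation [(mu - T) f = g] into the twisted equation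
   [f = G mu g + c mu * n * (f o gam)]; this covers both sides of the critical circle. *)
Lemma W_resolvent_of_twisted (m n : C -> C) (beta gam lam : C) (q delta : R)
  (c : C -> C) (G : C -> (C -> C) -> C -> C) :
  Hol n -> (forall z, inD z -> n z <> RtoC 0) -> Cmod gam = 1 ->
  (forall k, (1 <= k)%nat -> (gam ^ k)%C <> RtoC 1) -> 0 <= q < 1 -> 0 < delta ->
  (forall mu, Cmod (mu - lam) <= delta -> Cmod (c mu) * Cmod (n 0) <= q) ->
  (forall mu g, Cmod (mu - lam) <= delta -> Hol g -> Hol (G mu g)) ->
  (forall g r, Hol g -> 0 < r < 1 -> exists B, forall mu, Cmod (mu - lam) <= delta ->
     forall z, Cmod z <= r -> Cmod (G mu g z) <= B) ->
  (forall mu f g, Cmod (mu - lam) <= delta -> (eqD (shiftT m beta mu f) g <->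
     forall z, inD z -> f z = G mu g z + c mu * n z * f (gam * z))%C) ->
  in_W_resolvent m beta lam.
Proof.
  intros Hn N Hg Hroot Hq Hd Hc HG HB hE.
  assert (Res : forall mu, Cmod (mu - lam) <= delta -> in_resolvent m beta mu).
  { intros mu Hmu. split.
    - intros f Hf E z Hz. assert (E' := proj1 (hE mu f _ Hmu) E).
      (* Linearity of [G] is not assumed; the value at g = 0 follows by putting f = 0 into the
         equivalence of the two equations. *)
      assert (G0 : forall w, inD w -> G mu (fun _ => RtoC 0) w = RtoC 0).
      { intros w Hw. assert (E0 := proj1 (hE mu (fun _ => RtoC 0) (fun _ => RtoC 0) Hmu)).
        symmetry. rewrite E0 with (z := w) at 1; auto; [ring|].
        intros u _. unfold shiftT, Top. ring. }
      assert (P0 := Cmod_ge_0 z).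
      destruct (twisted_bound n gam q (Cmod z) Hn N Hg Hroot Hq) as [K HK]; [unfold inD in Hz; lra|].
      apply Cmod_eq_0. apply Rle_antisym; [|apply Cmod_ge_0].
      replace 0 with (K * 0) by ring.
      apply (HK (c mu) (Hc mu Hmu) f (G mu (fun _ => RtoC 0))); auto; [| |lra].
      + intros w Hw. apply E'. unfold inD in *; lra.
      + intros w Hw. rewrite G0, Cmod_0; [lra|]. unfold inD in *; lra.
    - intros g Hg'.
      destruct (twisted_solve n gam q (c mu) (G mu g) Hn N Hg Hroot Hq (Hc mu Hmu) (HG mu g Hmu Hg')) as [f [Hf E]].
      exists f. split; auto. now apply hE. }
  split.
  - apply Res. replace (lam - lam)%C with (RtoC 0) by ring. rewrite Cmod_0; lra.
  - exists delta. split; auto. split; [exact Res|].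
    intros g Hg' r Hr.
    destruct (twisted_bound n gam q r Hn N Hg Hroot Hq) as [K HK]; [lra|].
    destruct (HB g r Hg' Hr) as [B HB'].
    exists (K * B). intros mu Hmu f Hf E.
    apply (HK (c mu) (Hc mu Hmu) f (G mu g)); auto.
    intros z Hz. apply (proj1 (hE mu f g Hmu) E). unfold inD; lra.
Qed.

Lemma W_resolvent_large m beta lam : Hol m -> (forall z, inD z -> m z <> RtoC 0) ->
  Cmod beta = 1 -> (forall n, (1 <= n)%nat -> (beta ^ n)%C <> RtoC 1) ->
  Cmod (m 0) < Cmod lam -> in_W_resolvent m beta lam.
Proof.
  intros Hm N Hb Hroot Hl. assert (P0 := Cmod_ge_0 (m 0)).
  (* With delta half the gap between |lam| and |m(0)|, every admissible mu has |mu| >= L, so q =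
     |m(0)| / L < 1 works for all of them. *)
  set (L := (Cmod lam + Cmod (m 0)) / 2).
  assert (HL : 0 < L) by (unfold L; lra).
  assert (HL' : Cmod (m 0) < L) by (unfold L; lra).
  assert (Hmu : forall mu, Cmod (mu - lam) <= (Cmod lam - Cmod (m 0)) / 2 -> L <= Cmod mu).
  { intros mu H. generalize (Cmod_triangle_rev lam mu). rewrite Cmod_sub_sym. unfold L. lra. }
  assert (Nmu : forall mu, Cmod (mu - lam) <= (Cmod lam - Cmod (m 0)) / 2 -> mu <> RtoC 0).
  { intros mu H. apply Cmod_gt_0. specialize (Hmu mu H). lra. }
  assert (Imu : forall mu, Cmod (mu - lam) <= (Cmod lam - Cmod (m 0)) / 2 -> Cmod (/ mu) <= / L).
  { intros mu H. rewrite Cmod_inv by auto. apply Rinv_le_contravar; auto. }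
  apply (W_resolvent_of_twisted m m beta beta lam (Cmod (m 0) / L) ((Cmod lam - Cmod (m 0)) / 2)
           (fun mu => / mu)%C (fun mu g z => / mu * g z)%C); auto.
  - split; [apply Rdiv_le_0_compat; lra|apply Rlt_div_l; lra].
  - lra.
  - intros mu H. unfold Rdiv. rewrite Rmult_comm. apply Rmult_le_compat_l; auto.
  - intros mu g _ Hg. apply (Hol_mult (fun _ => / mu)%C g); auto. apply Hol_const.
  - intros g r Hg Hr. destruct (Hol_bounded g r Hg) as [M [HM0 HM]]; [lra|].
    exists (/ L * M). intros mu H z Hz. rewrite Cmod_mult.
    apply Rmult_le_compat; auto; apply Cmod_ge_0.
  - intros mu f g H. specialize (Nmu mu H). unfold eqD, shiftT, Top. split; intros E z Hz.
    + rewrite <- (E z Hz). field. auto.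
    + rewrite (E z Hz) at 1. field. auto.
Qed.

Lemma W_resolvent_small m beta lam : Hol m -> (forall z, inD z -> m z <> RtoC 0) ->
  Cmod beta = 1 -> (forall n, (1 <= n)%nat -> (beta ^ n)%C <> RtoC 1) ->
  Cmod lam < Cmod (m 0) -> in_W_resolvent m beta lam.
Proof.
  intros Hm N Hb Hroot Hl. assert (P0 := Cmod_ge_0 lam).
  assert (Nb : beta <> RtoC 0) by (apply Cmod_gt_0; lra).
  set (gam := (/ beta)%C).
  assert (Hg : Cmod gam = 1) by (unfold gam; rewrite Cmod_inv, Hb by auto; field).
  assert (Hgb : forall z, (gam * (beta * z) = z)%C) by (intros; unfold gam; field; auto).
  assert (Hbg : forall z, (beta * (gam * z) = z)%C) by (intros; unfold gam; field; auto).
  assert (Hm' : Hol (fun z => m (gam * z)%C)) by now apply Hol_rot.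
  assert (N' : forall z, inD z -> m (gam * z)%C <> RtoC 0) by (intros; apply N; now apply inD_rot).
  assert (E0 : m (gam * 0)%C = m 0) by (f_equal; ring).
  assert (N0 : m 0 <> RtoC 0) by (apply N; unfold inD; rewrite Cmod_0; lra).
  set (L := (Cmod lam + Cmod (m 0)) / 2).
  assert (HL : 0 <= L < Cmod (m 0)) by (unfold L; lra).
  (* The equation at gam z is solved for f(z) = f(beta gam z). This divides by m(gam z) and not by
     mu, so mu = 0 is covered; |mu| <= L gives q = L / |m(0)|. *)
  apply (W_resolvent_of_twisted m (fun z => / m (gam * z))%C beta gam lam (L / Cmod (m 0)) ((Cmod (m 0) - Cmod lam) / 2)
           (fun mu => mu) (fun mu g z => - (1) * (/ m (gam * z) * g (gam * z)))%C); auto.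
  - now apply Hol_inv.
  - intros z Hz E. specialize (N' z Hz). apply (Cmult_neq_0 (m (gam * z)%C) (/ m (gam * z))%C).
    + exact N'.
    + intros E'. apply (f_equal (fun x => m (gam * z) * x)%C) in E'. rewrite Cinv_r in E' by auto.
      rewrite Cmult_0_r in E'. apply RtoC_inj in E'. lra.
    + rewrite E. ring.
  - intros k Hk E. apply (Hroot k Hk).
    assert (E1 : (gam ^ k * beta ^ k)%C = RtoC 1).
    { rewrite <- Cpow_mult_l. unfold gam. rewrite Cinv_l, Cpow_1_l; auto. }
    rewrite E in E1. now rewrite Cmult_1_l in E1.
  - split; [apply Rdiv_le_0_compat; lra|apply Rlt_div_l; lra].
  - lra.
  - intros mu H. rewrite E0, Cmod_inv by auto. apply Rmult_le_compat_r.
    + left. apply Rinv_0_lt_compat. lra.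
    + generalize (Cmod_triangle_rev mu lam). unfold L. lra.
  - intros mu g _ Hg'. apply (Hol_mult (fun _ => - (1))%C); [apply Hol_const|].
    apply Hol_mult; [now apply Hol_inv|now apply Hol_rot].
  - intros g r Hg' Hr.
    destruct (Hol_bounded (fun z => - (1) * (/ m (gam * z) * g (gam * z)))%C r) as [M [_ HM]]; [|lra|eauto].
    apply (Hol_mult (fun _ => - (1))%C); [apply Hol_const|].
    apply Hol_mult; [now apply Hol_inv|now apply Hol_rot].
  - intros mu f g _. unfold eqD, shiftT, Top. split; intros E z Hz.
    + assert (Hz' := inD_rot gam z Hg Hz). rewrite <- (E _ Hz'), Hbg. field. auto.
    + assert (Hz' := inD_rot beta z Hb Hz). rewrite (E _ Hz'), Hgb. field. auto.
Qed.

(** * The spectrum *)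

Lemma Hol_zero_at_0 f : Hol f -> (forall z, inD z -> z <> RtoC 0 -> f z = RtoC 0) -> f (RtoC 0) = RtoC 0.
Proof.
  intros Hf H.
  assert (I0 : inD (RtoC 0)) by (unfold inD; rewrite Cmod_0; lra).
  destruct (proj1 (Hol_cdiff f) Hf _ I0) as [l Hl]. assert (Hc := cdiff_ccont _ _ _ Hl).
  apply Cmod_small_eq_0. intros e He. destruct (Hc e He) as [d [Hd Hw]].
  set (x := Rmin (d / 2) (1 / 2)).
  assert (Hx : 0 < x) by (apply Rmin_pos; lra).
  assert (Hx1 : x <= d / 2) by apply Rmin_l. assert (Hx2 : x <= 1 / 2) by apply Rmin_r.
  assert (Ex : Cmod x = x) by (rewrite Cmod_R, Rabs_pos_eq; lra).
  assert (W := Hw (RtoC x)). rewrite (H (RtoC x)) in W.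
  - replace (0 - f 0)%C with (- f 0)%C in W by ring. rewrite Cmod_opp in W. left. apply W.
    replace (x - 0)%C with (RtoC x) by ring. lra.
  - unfold inD. lra.
  - apply Cmod_gt_0. lra.
Qed.

(** The triangular system is solved by repeated division by z. If f = z^j h, the equation divided by
    z^j and read at 0 is [Eq]. For j < n its right side is 0 and the factor of h(0) is not, because
    beta^(n-j) <> 1; so h(0) = 0 and another z splits off. At j = n it says 0 = 1. *)
Lemma power_not_in_resolvent m beta n : Hol m -> m (RtoC 0) <> RtoC 0 -> Cmod beta = 1 ->
  (forall k, (1 <= k)%nat -> (beta ^ k)%C <> RtoC 1) -> ~ in_resolvent m beta (beta ^ n * m 0)%C.
Proof.
  intros Hm N0 Hb Hroot [_ Hsurj].
  set (lam := (beta ^ n * m 0)%C) in *.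
  assert (Nb : beta <> RtoC 0) by (apply Cmod_gt_0; lra).
  assert (I0 : inD (RtoC 0)) by (unfold inD; rewrite Cmod_0; lra).
  destruct (Hsurj (fun z => z ^ n)%C (Hol_pow n)) as [f [Hf E]].
  assert (Eq : forall j h, (j <= n)%nat -> Hol h -> (forall z, inD z -> f z = z ^ j * h z)%C ->
     ((lam - beta ^ j * m 0) * h (RtoC 0) = 0 ^ (n - j))%C).
  { intros j h Hj Hh Hfh.
    (* The equation after division by z^j: it vanishes away from 0 by the division, and at 0 by
       continuity. *)
    set (Phi := fun z => (lam * h z + - (beta ^ j) * (m z * h (beta * z)) + - (1) * z ^ (n - j))%C).
    assert (HPhi : Hol Phi).
    { unfold Phi. apply Hol_plus; [apply Hol_plus|].
      - apply (Hol_mult (fun _ => lam)); auto using Hol_const.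
      - apply (Hol_mult (fun _ => - (beta ^ j))%C); [apply Hol_const|]. apply Hol_mult; auto. now apply Hol_rot.
      - apply (Hol_mult (fun _ => - (1))%C); [apply Hol_const|apply Hol_pow]. }
    assert (Z : Phi (RtoC 0) = RtoC 0).
    { apply Hol_zero_at_0; auto. intros z Hz Nz.
      specialize (E z Hz). unfold shiftT, Top in E.
      rewrite (Hfh z Hz), (Hfh _ (inD_rot beta z Hb Hz)), Cpow_mult_l in E.
      replace (z ^ n)%C with (z ^ j * z ^ (n - j))%C in E by (rewrite <- Cpow_add_r; f_equal; lia).
      assert (Nzj := Cpow_nz z j Nz).
      replace (Phi z) with ((lam * (z ^ j * h z) - m z * (beta ^ j * z ^ j * h (beta * z)) - z ^ j * z ^ (n - j)) / z ^ j)%C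
        by (unfold Phi; field; auto).
      rewrite E. field. auto. }
    unfold Phi in Z. replace (beta * 0)%C with (RtoC 0) in Z by ring.
    revert Z. generalize (0 ^ (n - j))%C. intros p Z.
    transitivity (p + (lam * h 0 + - beta ^ j * (m 0 * h 0) + - (1) * p))%C; [ring|]. rewrite Z. ring. }
  assert (Div : forall j, (j <= n)%nat -> exists h, Hol h /\ forall z, inD z -> (f z = z ^ j * h z)%C).
  { induction j; intros Hj.
    - exists f. split; auto. intros z _. simpl. ring.
    - destruct IHj as [h [Hh Hfh]]; [lia|].
      assert (E1 := Eq j h ltac:(lia) Hh Hfh).
      assert (H0 : h (RtoC 0) = RtoC 0).
      { destruct (n - j)%nat as [|p] eqn:Ep; [lia|].
        rewrite Cpow_S, Cmult_0_l in E1.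
        apply NNPP. intros Nh. apply (Cmult_neq_0 (lam - beta ^ j * m 0)%C (h (RtoC 0))); auto.
        intros E2. apply (Hroot (S p)); [lia|].
        replace (beta ^ S p)%C with ((lam - beta ^ j * m 0) / (beta ^ j * m 0) + 1)%C.
        - rewrite E2. field. split; auto. now apply Cpow_nz.
        - unfold lam. replace n with (j + S p)%nat by lia. rewrite Cpow_add_r. field.
          split; auto. now apply Cpow_nz. }
      destruct (Hol_div_id h Hh H0) as [h1 [Hh1 Eh]].
      exists h1. split; auto. intros z Hz. rewrite (Hfh z Hz), (Eh z Hz), Cpow_S. ring. }
  destruct (Div n (Nat.le_refl n)) as [h [Hh Hfh]].
  assert (E1 := Eq n h (Nat.le_refl n) Hh Hfh).
  rewrite Nat.sub_diag in E1. unfold lam in E1.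
  replace ((beta ^ n * m 0 - beta ^ n * m 0) * h 0)%C with (RtoC 0) in E1 by ring.
  simpl in E1. apply RtoC_inj in E1. lra.
Qed.

(** The second summand is half the Poisson kernel (1 - |w|^2) / |1 - w|^2, so the geometric series
    in w has small real part when |w| is near 1 and w is away from 1. *)
Lemma Re_inv_one_minus w : (1 - w)%C <> RtoC 0 ->
  fst (/ (1 - w))%C = / 2 + (1 - Cmod w ^ 2) / (2 * Cmod (1 - w) ^ 2).
Proof.
  intros H. assert (P : 0 < Cmod (1 - w)) by now apply Cmod_gt_0.
  assert (E1 := Cmod2_alt w). assert (E2 := Cmod2_alt (1 - w)).
  assert (P2 : 0 < Cmod (1 - w) ^ 2) by (apply pow_lt; auto).
  rewrite E1, E2. rewrite E2 in P2. clear E1 E2.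
  destruct w as [x y]. unfold Re, Im in *. simpl in *. field.
  nra.
Qed.

(* If the orbit avoided a neighbourhood of [om], the Poisson kernel with pole near [om] would be
   uniformly below its mean 1 along the orbit, against the boundedness of Birkhoff sums. *)
Lemma orbit_dense g om delta : Cmod g = 1 -> (forall k, (1 <= k)%nat -> (g ^ k)%C <> RtoC 1) ->
  Cmod om = 1 -> 0 < delta -> exists k, Cmod (g ^ k - om) < delta.
Proof.
  intros Hg Hroot Hom Hd. apply NNPP. intros Hn.
  assert (Far : forall k, delta <= Cmod (g ^ k - om)).
  { intros k. apply Rnot_lt_le. intros H. apply Hn. now exists k. }
  assert (Hd2 : delta <= 2).
  { eapply Rle_trans; [apply (Far 0%nat)|]. eapply Rle_trans; [apply Cmod_minus_le|].
    rewrite Cmod_pow_unit; lra. }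
  assert (Nom : om <> RtoC 0) by (apply Cmod_gt_0; lra).
  (* Moves [om] to 1: the distance of g^k z0 from 1 is that of g^k from [om]. *)
  set (z0 := (/ om)%C).
  assert (Hz0 : Cmod z0 = 1) by (unfold z0; rewrite Cmod_inv, Hom; auto; field).
  (* Since delta <= 2, eta <= delta / 16 and shrinking the orbit by s = 1 - eta keeps |1 - w| >=
     delta / 2. Then 1 - s^2 <= delta^2 / 16 while 2 |1 - w|^2 >= delta^2 / 2, so the kernel term is
     at most 1/8. *)
  set (eta := delta ^ 2 / 32).
  assert (Heta : 0 < eta <= delta / 16) by (unfold eta; nra).
  set (s := 1 - eta).
  assert (Hs : 0 <= s < 1) by (unfold s; lra).
  (* Truncation at J turns the kernel into a polynomial without constant term, to which
     [birkhoff_poly] applies; the discarded tail is at most s^(J+1) / (1 - s) <= 1/8. *)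
  destruct (geom_small (s / (1 - s)) s (1 / 8) Hs) as [J HJ]; [lra|].
  specialize (HJ J (Nat.le_refl J)).
  destruct (birkhoff_poly g (fun j => RtoC s ^ S j)%C J Hg Hroot) as [B HB].
  specialize (HB z0 ltac:(lra)).
  (* The budget is 5/8 for Re(1 / (1 - w)), minus 1 for the missing constant term, plus 1/8 for the
     tail: -1/4. *)
  assert (Term : forall k, fst (csum (fun j => RtoC s ^ S j * (g ^ k * z0) ^ S j)%C J) <= - (1 / 4)).
  { intros k. set (z := (g ^ k * z0)%C).
    assert (Hz : Cmod z = 1) by (unfold z; rewrite Cmod_mult, Cmod_pow_unit; lra).
    set (w := (RtoC s * z)%C).
    assert (Hw : Cmod w = s) by (unfold w; rewrite Cmod_mult, Hz, Cmod_R, Rabs_pos_eq; lra).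
    assert (Nw : (1 - w)%C <> RtoC 0).
    { apply Cmod_gt_0. generalize (Cmod_triangle_rev 1 w). rewrite Cmod_1, Hw. lra. }
    assert (Dz : delta <= Cmod (1 - z)).
    { replace (1 - z)%C with (- (z0 * (g ^ k - om)))%C by (unfold z, z0; field; auto).
      rewrite Cmod_opp, Cmod_mult, Hz0, Rmult_1_l. auto. }
    assert (Dw : delta / 2 <= Cmod (1 - w)).
    { assert (T := Cmod_triangle_rev (1 - z) (w - z)).
      replace (1 - z - (w - z))%C with (1 - w)%C in T by ring.
      assert (Cmod (w - z) = eta).
      { replace (w - z)%C with (RtoC (- eta) * z)%C by (unfold w, s; rewrite RtoC_minus, RtoC_opp; ring).
        rewrite Cmod_mult, Hz, Cmod_R, Rabs_Ropp, Rabs_pos_eq; lra. }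
      lra. }
    assert (Pw : 0 < Cmod (1 - w)) by lra.
    assert (R1 : fst (/ (1 - w))%C <= 5 / 8).
    { rewrite Re_inv_one_minus, Hw by auto.
      assert (D2 : delta ^ 2 / 4 <= Cmod (1 - w) ^ 2) by nra.
      assert ((1 - s ^ 2) / (2 * Cmod (1 - w) ^ 2) <= 1 / 8); [|lra].
      apply Rle_div_l; [nra|]. unfold s. unfold eta in *. nra. }
    assert (R2 : Cmod (w ^ S J / (1 - w)) <= 1 / 8).
    { rewrite Cmod_div, Cmod_pow, Hw by auto. eapply Rle_trans; [|exact HJ].
      replace (s / (1 - s) * s ^ J) with (s ^ S J * / (1 - s)) by (simpl; field; lra).
      apply Rmult_le_compat_l; [apply pow_le; lra|]. apply Rinv_le_contravar; [lra|].
      generalize (Cmod_triangle_rev 1 w). rewrite Cmod_1, Hw. lra. }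
    assert (R3 : Rabs (fst (w ^ S J / (1 - w))%C) <= 1 / 8).
    { eapply Rle_trans; [eapply Rle_trans; [apply Rmax_l|apply Rmax_Cmod]|exact R2]. }
    assert (Id : csum (fun j => RtoC s ^ S j * z ^ S j)%C J = (/ (1 - w) - 1 - w ^ S J / (1 - w))%C).
    { rewrite (csum_ext _ (fun j => w * w ^ j)%C).
      2:{ intros j _. rewrite <- Cpow_mult_l. reflexivity. }
      rewrite (csum_scal w (fun j => w ^ j)%C).
      assert (Gm := geom_csum w J).
      replace (csum (fun j => w ^ j)%C J) with (- ((w - 1) * csum (fun j => w ^ j) J) / (1 - w))%C by (field; auto).
      rewrite Gm, Cpow_S. field. auto. }
    rewrite Id. apply Rabs_le_between in R3.
    change (fst (/ (1 - w))%C - 1 - fst (w ^ S J / (1 - w))%C <= - (1 / 4)). lra. }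
  assert (Sum : forall N, fst (csum (fun k => csum (fun j => RtoC s ^ S j * (g ^ k * z0) ^ S j)%C J) N) <= - (INR N / 4)).
  { induction N; [simpl; lra|]. rewrite S_INR. cbn [csum].
    match goal with |- fst (?a + ?b)%C <= _ => change (fst a + fst b <= - ((INR N + 1) / 4)) end.
    specialize (Term N). lra. }
  (* The N-th sum has real part at most -N/4 and modulus at most B, impossible for N > 4 B. *)
  destruct (INR_unbounded (4 * B)) as [N HN].
  specialize (Sum N). specialize (HB N).
  match type of HB with Cmod ?a <= _ =>
    assert (T : Rabs (fst a) <= Cmod a) by (eapply Rle_trans; [apply Rmax_l|apply Rmax_Cmod]) end.
  assert (T' := Rle_trans _ _ _ T HB). apply Rabs_le_between in T'. lra.
Qed.

Theorem theorem7p3 (beta : C) (m : C -> C)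
  (hbeta : Cmod beta = 1)
  (hroot : forall n : nat, (1 <= n)%nat -> Cpow beta n <> RtoC 1)
  (hm : Hol m)
  (hm0 : forall z, inD z -> m z <> RtoC 0) :
  ((forall n : nat, in_spectrum m beta (Cmult (Cpow beta n) (m (RtoC 0)))) /\
   (forall lam : C, in_spectrum m beta lam -> Cmod lam = Cmod (m (RtoC 0)))) /\
  (forall lam : C, in_W_spectrum m beta lam <-> Cmod lam = Cmod (m (RtoC 0))).
Proof.
  assert (N0 : m (RtoC 0) <> RtoC 0) by (apply hm0; unfold inD; rewrite Cmod_0; lra).
  assert (P0 : 0 < Cmod (m (RtoC 0))) by now apply Cmod_gt_0.
  assert (Spec : forall n, in_spectrum m beta (beta ^ n * m 0)%C)
    by (intros n; now apply power_not_in_resolvent).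
  assert (Off : forall lam, Cmod lam <> Cmod (m (RtoC 0)) -> in_W_resolvent m beta lam).
  { intros lam H. destruct (Rtotal_order (Cmod lam) (Cmod (m (RtoC 0)))) as [L|[L|L]].
    - now apply W_resolvent_small.
    - easy.
    - now apply W_resolvent_large. }
  split; [split; [exact Spec|]|].
  - intros lam H. apply NNPP. intros Hn. apply H. now apply Off.
  - intros lam. split.
    + intros H. apply NNPP. intros Hn. apply H. now apply Off.
    + intros E [_ [delta [Hd [Hres _]]]].
      (* Division by m(0) carries the critical circle to the unit circle and scales delta
         accordingly. *)
      destruct (orbit_dense beta (lam / m 0)%C (delta / Cmod (m 0)) hbeta hroot) as [k Hk].
      * rewrite Cmod_div, E by auto. field. lra.
      * now apply Rdiv_lt_0_compat.
      * apply (Spec k), Hres.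
        replace (beta ^ k * m 0 - lam)%C with ((beta ^ k - lam / m 0) * m 0)%C by (field; auto).
        rewrite Cmod_mult. left.
        apply Rmult_lt_compat_r with (r := Cmod (m 0)) in Hk; auto.
        replace (delta / Cmod (m 0) * Cmod (m 0)) with delta in Hk by (field; lra). exact Hk.
Qed.
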